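(* For every dimension $d\ge 1$ there exists a constant $C\in(0,\infty)$ depending only on $d$ such that the following holds. Let $\nu$ be a non-negative locally finite measure on $\mathbb{R}^d$ and let $u:\mathbb{R}^d\to\mathbb{R}$ be a $C^2$-function such that $\Delta u=\nu-m_d$ (that is, $\nu-m_d$ is the signed measure with density $\Delta u$ with respect to $m_d$). Then $$\mathrm{Tra}(\nu)\le C\sqrt{\|u\|_\infty}.$$
   Context: $m_d$ is the $d$-dimensional Lebesgue measure on $\mathbb{R}^d$, $|\cdot|$ is the Euclidean norm, $\|u\|_\infty=\sup_{\mathbb{R}^d}|u|\in[0,\infty]$. A measure is locally finite if it is a Borel measure finite on bounded sets. Transportation distance: for non-negative locally finite measures $\nu_1,\nu_2$ on $\mathbb{R}^d$, a transportation from $\nu_1$ to $\nu_2$ is a non-negative locally finite measure $\gamma$ on $\mathbb{R}^d\times\mathbb{R}^d$ with marginals $\nu_1$ and $\nu_2$, i.e. $\iint \varphi(x)\,d\gamma(x,y)=\int\varphi\,d\nu_1$ and $\iint \varphi(y)\,d\gamma(x,y)=\int\varphi\,d\nu_2$ for all continuous compactly supported $\varphi:\mathbb{R}^d\to\mathbb{R}$. Set $$\mathrm{Tra}(\nu_1,\nu_2)=\inf_\gamma \sup\{|x-y| : (x,y)\in\operatorname{spt}(\gamma)\}\in[0,\infty],$$ the infimum being over all transportations $\gamma$ from $\nu_1$ to $\nu_2$ (it is $+\infty$ if there are none), where $\operatorname{spt}$ is the closed support. Set $\mathrm{Tra}(\nu)=\mathrm{Tra}(\nu,m_d)$. *)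

(* Defs.v *)
From HB Require Import structures.
From mathcomp Require Import all_boot all_order all_algebra.
From mathcomp Require Import all_classical all_reals all_analysis.
Set Implicit Arguments.
Unset Strict Implicit.
Unset Printing Implicit Defensive.
Import Order.TTheory GRing.Theory Num.Theory.
Import numFieldNormedType.Exports.
Local Open Scope classical_set_scope.
Local Open Scope ring_scope.

(* The Euclidean space R^d is 'rV[R]_d, with its Borel sigma-algebra. On
   R^d x R^d the library provides the product sigma-algebra; as R^d is second
   countable it is again the Borel one, see open_prod_measurable. *)
HB.instance Definition _ (R : realType) (m n : nat) :=
  @isMeasurable.Build (sigma_display (@open 'M[R]_(m, n))) 'M[R]_(m, n)
    <<s @open 'M[R]_(m, n) >>
    (@sigma_algebra0 _ setT _) (@sigma_algebraC _ _)
    (@sigma_algebra_bigcup _ setT _).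

Section borel.
Context {R : realType}.

Lemma open_mx_measurable m n (U : set 'M[R]_(m, n)) : open U -> measurable U.
Proof. exact: sub_sigma_algebra. Qed.

Lemma mx_rat_approx m n (x : 'M[R]_(m, n)) (e : R) : 0 < e ->
  exists q : 'M[rat]_(m, n), ball x e (map_mx ratr q).
Proof.
move=> e0.
have /choice[f Hf] : forall ij : 'I_m * 'I_n,
    exists q : rat, `|x ij.1 ij.2 - ratr q| < e.
  move=> [i j] /=.
  have /rat_in_itvoo[q /itvP qP] : x i j - e < x i j + e.
    by rewrite ltrBlDr -addrA ltrDl addr_gt0.
  by exists q; rewrite ltr_distlC !qP.
exists (\matrix_(i, j) f (i, j)); split => // i j.
by rewrite !mxE; exact: (Hf (i, j)).
Qed.

Lemma open_prod_measurable m n (U : set ('rV[R]_m * 'rV[R]_n)) :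
  open U -> measurable U.
Proof.
move=> oU.
pose I : countType := ('rV[rat]_m * 'rV[rat]_n * nat)%type.
pose B (i : I) : set ('rV[R]_m * 'rV[R]_n) :=
  ball (map_mx ratr i.1.1 : 'rV[R]_m) i.2.+1%:R^-1 `*`
  ball (map_mx ratr i.1.2 : 'rV[R]_n) i.2.+1%:R^-1.
have -> : U = \bigcup_i (if `[< B i `<=` U >] then B i else set0).
  apply/seteqP; split => [[x y] Uxy|z [i _]]; last first.
    by case: asboolP => // /[apply].
  have /nbhs_ballP[e /= e0 eU] : nbhs (x, y) U by exact: open_nbhs_nbhs.
  have [k ke] : exists k : nat, k.+1%:R^-1 < e / 2.
    have := @near_infty_natSinv_lt R (PosNum (divr_gt0 e0 (ltr0n R 2))).
    by case=> N _ /(_ N (leqnn _)) NP; exists N.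
  have k0 : 0 < k.+1%:R^-1 :> R by rewrite invr_gt0.
  have [p xp] := mx_rat_approx x k0.
  have [q yq] := mx_rat_approx y k0.
  exists ((p, q), k) => //; case: asboolP => [_|]; first by split; apply: ball_sym.
  case=> -[x' y'] [/= px' qy']; apply: eU; rewrite (splitr e).
  by split => /=; apply: ball_triangle; apply: le_ball (ltW ke) _ _; eassumption.
apply: countable_bigcupT_measurable => [|i]; first exact: countableP.
case: asboolP => // _; apply: measurableX; apply: open_mx_measurable;
  by apply: ball_open; rewrite invr_gt0.
Qed.

Lemma measurable_row_mx m n :
  measurable_fun setT (fun p : 'rV[R]_m * 'rV[R]_n => row_mx p.1 p.2).
Proof.
apply: (@measurability _ _ _ _ _ _ (@open 'rV[R]_(m + n))) => //.
move=> _ [U oU <-]; rewrite setTI; apply: open_prod_measurable.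
rewrite openE => -[x y] /= Uxy.
have /nbhs_ballP[e /= e0 eU] : nbhs (row_mx x y) U by exact: open_nbhs_nbhs.
apply/nbhs_ballP; exists e => //= -[x' y'] [/= [_ xx'] [_ yy']].
apply: eU; split => // i j; rewrite !mxE; case: splitP => k _; [exact: xx'|exact: yy'].
Qed.

Lemma measurable_scalar_mx1 :
  measurable_fun setT (fun t : measurableTypeR R => t%:M : 'rV[R]_1).
Proof.
apply: (@measurability _ _ _ _ _ _ (@open 'rV[R]_1)) => //.
move=> _ [U oU <-]; rewrite setTI; apply: measurable_realfun.open_measurable.
rewrite openE => t /= Ut.
have /nbhs_ballP[e /= e0 eU] : nbhs (t%:M : 'rV[R]_1) U by exact: open_nbhs_nbhs.
apply/nbhs_ballP; exists e => //= s ts.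
by apply: eU; split => // i j; rewrite !mxE !ord1 !mulr1n.
Qed.

Definition cons_row d (p : 'rV[R]_d * measurableTypeR R) : 'rV[R]_d.+1 :=
  row_mx (p.2%:M : 'rV[R]_1) p.1.

Lemma measurable_cons_row d : measurable_fun setT (@cons_row d).
Proof.
have mp : measurable_fun setT
    (fun p : 'rV[R]_d * measurableTypeR R => (p.2%:M : 'rV[R]_1, p.1)).
  apply: measurable_fun_pair; last exact: measurable_fst.
  exact: (measurableT_comp measurable_scalar_mx1 measurable_snd).
exact: (measurableT_comp (@measurable_row_mx 1 d) mp).
Qed.

Lemma measurable_coord d (i : 'I_d) :
  measurable_fun setT (fun x : 'rV[R]_d => x 0 i : measurableTypeR R).
Proof.
apply: (@measurability _ _ _ _ _ _ (@measurable_realfun.RGenOpens.G R)).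
  exact: measurable_realfun.RGenOpens.measurableE.
move=> _ [_ [a [b ->]] <-]; rewrite setTI; apply: open_mx_measurable.
apply: open_comp; last exact: interval_open.
by move=> x _; exact: coord_continuous.
Qed.

End borel.

(* The d-dimensional Lebesgue measure: a Dirac mass on the one-point space R^0;
   on R^(d+1), the image of the product of the measures on R^d and R under the
   identification of R^d x R with R^(d+1). *)
Section lebesgue_rV.
Context {R : realType}.

Section step.
Variables (d : nat) (mu : {measure set 'rV[R]_d -> \bar R}).

Definition lebesgue_rV_step : set 'rV[R]_d.+1 -> \bar R :=
  pushforward (mu \x @lebesgue_measure R)%E (@cons_row R d).

Let step0 : lebesgue_rV_step set0 = 0%E.
Proof. by rewrite /lebesgue_rV_step /pushforward preimage_set0 measure0. Qed.

Let step_ge0 A : (0 <= lebesgue_rV_step A)%E.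
Proof. by rewrite /lebesgue_rV_step /pushforward; exact: measure_ge0. Qed.

Let step_sigma_additive : semi_sigma_additive lebesgue_rV_step.
Proof.
exact: (@measure_semi_sigma_additive _ _ _
  (measure_function_pushforward__canonical__measure_function_Measure
    _ (@measurable_cons_row R d))).
Qed.

HB.instance Definition _ := isMeasure.Build _ _ _ lebesgue_rV_step
  step0 step_ge0 step_sigma_additive.

End step.

Fixpoint lebesgue_rV d : {measure set 'rV[R]_d -> \bar R} :=
  if d is d'.+1 then lebesgue_rV_step (lebesgue_rV d') else \d_(0 : 'rV[R]_0).

End lebesgue_rV.
Arguments lebesgue_rV R d : clear implicits.

Lemma lebesgue_rV_box (R : realType) d (A : 'I_d -> set R) :
  (forall i, measurable (A i)) ->
  lebesgue_rV R d [set x | forall i, A i (x 0 i)] =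
  (\prod_(i < d) @lebesgue_measure R (A i))%E.
Proof.
elim: d A => [A _|d IH A mA].
  rewrite big_ord0 /= diracE mem_set// => -[] //.
pose B := [set x : 'rV[R]_d | forall i : 'I_d, A (lift ord0 i) (x 0 i)].
have mB : measurable B.
  have -> : B = \bigcap_(i in [set: 'I_d])
      ((fun x : 'rV[R]_d => x 0 i) @^-1` A (lift ord0 i)).
    by apply/seteqP; split => [x + i _|x + i]; [exact|move=> /(_ i I)].
  apply: fin_bigcap_measurable => // i _.
  by rewrite -[X in measurable X]setTI; apply: (measurable_coord i) => //; exact: mA.
rewrite big_ord_recl -IH; last by move=> i; exact: mA.
rewrite muleC -product_measure1E//=; last exact: mA.
rewrite /lebesgue_rV_step /pushforward; congr product_measure1.
apply/seteqP; split => [[x t]/= H|[x t]/= [H1 H2] i].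
  split => [i|].
    have := H (lift ord0 i); rewrite /cons_row mxE; case: splitP => // j /=.
      by rewrite ord1.
    by rewrite /bump leq0n !add1n => -[] /val_inj ->.
  have := H ord0; rewrite /cons_row mxE; case: splitP => // j _ /=.
  by rewrite ord1 mxE.
rewrite /cons_row mxE; case: splitP => j ij.
  have -> : i = ord0 by apply/val_inj => /=; rewrite ij ord1.
  by rewrite ord1 mxE.
by have -> : i = lift ord0 j by apply/val_inj.
Qed.

Section transportation.
Context {R : realType} {d : nat}.
Local Notation Rd := 'rV[R]_d.
Implicit Types (nu : {measure set Rd -> \bar R})
  (gamma : {measure set (Rd * Rd) -> \bar R}).

(* The library norm `|x| on 'rV[R]_d is the sup norm; it has the same bounded
   sets and the same topology as the Euclidean norm. *)
Definition enorm (x : Rd) : R := Num.sqrt (\sum_(i < d) x 0 i ^+ 2).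

Definition locally_finite nu :=
  forall A : set Rd, measurable A -> bounded_set A -> (nu A < +oo)%E.

Definition locally_finite2 gamma :=
  forall A : set (Rd * Rd), measurable A -> bounded_set A -> (gamma A < +oo)%E.

Definition compactly_supported (phi : Rd -> R) :=
  compact (closure [set x | phi x != 0]).

Definition transportation nu1 nu2 gamma :=
  locally_finite2 gamma /\
  forall phi : Rd -> R, continuous phi -> compactly_supported phi ->
    (\int[gamma]_z (phi z.1)%:E = \int[nu1]_x (phi x)%:E)%E /\
    (\int[gamma]_z (phi z.2)%:E = \int[nu2]_y (phi y)%:E)%E.

Definition spt gamma : set (Rd * Rd) :=
  [set z | forall U : set (Rd * Rd), open U -> U z -> (0 < gamma U)%E].

(* A supremum of distances is taken in [0, +oo], so it is 0 on an empty
   support, whereas ereal_sup set0 = -oo. *)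
Definition transport_cost gamma : \bar R :=
  maxe 0%E (ereal_sup [set (enorm (z.1 - z.2))%:E | z in spt gamma]).

Definition Tra2 nu1 nu2 : \bar R :=
  ereal_inf [set transport_cost gamma | gamma in transportation nu1 nu2].

Definition Tra nu : \bar R := Tra2 nu (lebesgue_rV R d).

End transportation.

Section laplacian.
Context {R : realType} {d : nat}.
Local Notation Rd := 'rV[R]_d.
Implicit Types u f : Rd -> R.

Definition partial (i : 'I_d) u : Rd -> R := 'D_(delta_mx 0 i) u.

Definition C1_fun u :=
  continuous u /\
  forall i, (forall x, derivable u x (delta_mx 0 i)) /\
            continuous (partial i u).

Definition C2_fun u := C1_fun u /\ forall i, C1_fun (partial i u).

Definition laplacian u (x : Rd) : R := \sum_(i < d) partial i (partial i u) x.

(* The signed measure nu1 - nu2 has density f with respect to m_d. For locally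
   finite nu1, nu2 the difference is defined on bounded Borel sets only. *)
Definition diff_has_density (nu1 nu2 : {measure set Rd -> \bar R}) f :=
  forall A : set Rd, measurable A -> bounded_set A ->
    (nu1 A - nu2 A = \int[lebesgue_rV R d]_(x in A) (f x)%:E)%E.

Definition sup_norm u : \bar R := ereal_sup [set `|u x|%:E | x in setT].

End laplacian.

(* Main.v *)
Require Import Defs.
From HB Require Import structures.
From mathcomp Require Import all_boot all_order all_algebra.
From mathcomp Require Import all_classical all_reals all_analysis.
From mathcomp Require Import measurable_realfun ring lra.
Set Implicit Arguments.
Unset Strict Implicit.
Unset Printing Implicit Defensive.
Import Order.TTheory GRing.Theory Num.Theory.
Import numFieldNormedType.Exports.
Local Open Scope classical_set_scope.
Local Open Scope ring_scope.

(** Since the signed measure has a continuous density, [nu] itself has the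
    density [rho = 1 + laplacian u], which is nonnegative. Adding a constant to
    [u] does not change its Laplacian, so one may assume [0 <= u <= S] with
    [S] twice the sup norm of [u]. Fix a length [L] with [4 d S <= L^2]. The
    transportation is built at the scale [L] in two steps, both with explicit
    densities, through an intermediate density [N].

    The first step smooths [rho] with [phi], the tensor product over the
    coordinates of the quadratic B-spline with knots [0, L, 2L, 3L]: mass at
    [x] is spread to [z] with density [phi (x - z)]. The result
    [N z = int rho x phi (x - z) dx] has a discrete structure, because a
    spline of order [k + 2] is a double average of one of order [k]: an
    integration by parts along each coordinate direction ([pairing_ibp], twice)
    turns the Laplacian into second differences with step [L],
      [N z = 1 + sum_i (K_i (z + 2 L e_i) - 2 K_i (z + L e_i) + K_i z)],
    where [K_i z] is [L^-2] times an average of [u] ([pairing_density]). Hence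
    [0 <= K_i <= S / L^2], which is at most [1 / (4 d)].

    Such an [N] is exactly the density obtained from Lebesgue measure by a
    lazy random walk: at [y] jump to [y + L e_i] and to [y - L e_i], each with
    probability [K_i (y + L e_i)], and otherwise stay, which has probability at
    least [1 / 2]. Read backwards, the walk transports [N] to Lebesgue measure
    over distance [L]. Spreading the starting point with [phi] once more, which
    preserves Lebesgue measure, turns the walk into a plan with a density
    ([integral_walk_r], [integral_walk_l]).

    As [N >= 1 / 2], the two plans can be composed over their common marginal
    [N] ([glued_fst], [glued_snd]). The composed plan moves every coordinate by
    at most [4 L] ([plan_supp]), so the cost is at most [4 sqrt d L], and [L]
    can be taken arbitrarily close to [sqrt (4 d S)]. *)

(** * Measurable maps into row vectors *)

Section measurability.
Context {R : realType}.

Lemma measurable_to_row d0 (T : measurableType d0) d (f : T -> 'rV[R]_d) :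
  (forall U : set 'rV[R]_d, open U -> measurable (f @^-1` U)) ->
  measurable_fun setT f.
Proof.
move=> mf; apply: (@measurability _ _ _ _ _ _ (@open 'rV[R]_d)) => //.
by move=> _ [U oU <-]; rewrite setTI; exact: mf.
Qed.

Lemma measurable_row_continuous m (f : 'rV[R]_m -> R) :
  continuous f -> measurable_fun setT (f : _ -> measurableTypeR R).
Proof.
move=> cf; apply: (@measurability _ _ _ _ _ _ (@measurable_realfun.RGenOpens.G R)).
  exact: measurable_realfun.RGenOpens.measurableE.
move=> _ [_ [a [b ->]] <-]; rewrite setTI; apply: open_mx_measurable.
by apply: open_comp; [move=> x _; exact: cf|exact: interval_open].
Qed.

Lemma measurable_row_add d0 (T : measurableType d0) d (f g : T -> 'rV[R]_d) :
  measurable_fun setT f -> measurable_fun setT g ->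
  measurable_fun setT (fun x => f x + g x).
Proof.
move=> mf mg.
have madd : measurable_fun setT (fun p : 'rV[R]_d * 'rV[R]_d => p.1 + p.2).
  apply: measurable_to_row => U oU; apply: open_prod_measurable.
  by apply: open_comp oU => p _; exact: add_continuous.
exact: (measurableT_comp madd (measurable_fun_pair mf mg)).
Qed.

Lemma measurable_row_opp d0 (T : measurableType d0) d (f : T -> 'rV[R]_d) :
  measurable_fun setT f -> measurable_fun setT (fun x => - f x).
Proof.
move=> mf; have mopp : measurable_fun setT (fun p : 'rV[R]_d => - p).
  apply: measurable_to_row => U oU; apply: open_mx_measurable.
  by apply: open_comp oU => p _; exact: opp_continuous.
exact: (measurableT_comp mopp mf).
Qed.

Lemma measurable_row_sub d0 (T : measurableType d0) d (f g : T -> 'rV[R]_d) :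
  measurable_fun setT f -> measurable_fun setT g ->
  measurable_fun setT (fun x => f x - g x).
Proof. by move=> mf mg; apply/measurable_row_add/measurable_row_opp. Qed.

Lemma measurable_row_scale d0 (T : measurableType d0) d
    (f : T -> measurableTypeR R) (v : 'rV[R]_d) :
  measurable_fun setT f -> measurable_fun setT (fun x => (f x : R) *: v).
Proof.
move=> mf.
have msc : measurable_fun setT (fun t : measurableTypeR R => (t : R) *: v).
  apply: measurable_to_row => U oU; apply: measurable_realfun.open_measurable.
  by apply: open_comp oU => t _; exact: scalel_continuous.
exact: (measurableT_comp msc mf).
Qed.

Lemma measurable_row_prod n (h : 'I_n -> R -> R) :
  (forall i, measurable_fun setT (h i)) ->
  measurable_fun setT (fun x : 'rV[R]_n => \prod_(i < n) h i (x 0 i)).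
Proof.
move=> mh; apply: measurable_prod => i _.
apply: (measurableT_comp (mh i)); exact: measurable_coord.
Qed.

End measurability.

(** * Lebesgue measure on row vectors *)

Section lebesgue.
Context {R : realType}.

Lemma measurable_box d (A : 'I_d -> set R) : (forall i, measurable (A i)) ->
  measurable [set x : 'rV[R]_d | forall i, A i (x 0 i)].
Proof.
move=> mA.
have -> : [set x : 'rV[R]_d | forall i, A i (x 0 i)] =
    \bigcap_(i in [set: 'I_d]) ((fun x : 'rV[R]_d => x 0 i) @^-1` A i).
  by apply/seteqP; split => [x + i _|x + i]; [exact|move=> /(_ i I)].
apply: fin_bigcap_measurable => // i _.
by rewrite -[X in measurable X]setTI; apply: (measurable_coord i) => //;
  exact: mA.
Qed.

Let side (M : R) : set R := `[- M, M]%classic.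

Definition cube d (M : R) : set 'rV[R]_d :=
  [set x | forall i, `[- M, M]%classic (x 0 i)].
Arguments cube : clear implicits.

Lemma measurable_cube d M : measurable (cube d M).
Proof. by apply: (@measurable_box d (fun=> side M)) => i;
  exact: measurable_itv. Qed.

Lemma lebesgue_cube_lty d M : (lebesgue_rV R d (cube d M) < +oo)%E.
Proof.
rewrite (lebesgue_rV_box (A := fun=> side M)); last by move=> i;
  exact: measurable_itv.
suff : (0 <= \prod_(i < d) lebesgue_measure (side M) < +oo)%E.
  by case/andP.
elim/big_ind : _ => [|x y /andP[x0 xoo] /andP[y0 yoo]|i _].
- by rewrite lee_fin ler01 ltry.
- by rewrite mule_ge0//= lte_mul_pinfty// ge0_fin_numE.
- by rewrite measure_ge0/= /side lebesgue_measure_itv/=; case: ifPn =>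
  _; exact: ltry.
Qed.

Lemma bigcup_cube d : \bigcup_n cube d n%:R = setT.
Proof.
apply/seteqP; split => // x _.
have [n xn] : exists n : nat, (\sum_i `|x 0 i| < n%:R).
  by exists (Num.truncn (\sum_i `|x 0 i|)).+1; exact: truncnS_gt.
exists n => // i /=; rewrite in_itv/= -ler_norml (le_trans _ (ltW xn))//.
by rewrite (bigD1 i)//= lerDl sumr_ge0.
Qed.

Lemma lebesgue_sigma_finite d : sigma_finite setT (lebesgue_rV R d).
Proof.
exists (fun n => cube d n%:R); first by rewrite bigcup_cube.
by move=> n; split; [exact: measurable_cube|exact: lebesgue_cube_lty].
Qed.

(** A name of its own for the Lebesgue measure, so that the sigma-finite
    structure that Fubini's theorem asks for can be attached to it. *)
Definition leb d : set 'rV[R]_d -> \bar R := lebesgue_rV R d.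
Arguments leb : clear implicits.
HB.instance Definition _ d := Measure.on (leb d).
HB.instance Definition _ d :=
  Measure_isSigmaFinite.Build _ _ _ (leb d) (@lebesgue_sigma_finite d).

Local Open Scope ereal_scope.

Lemma lebesgue_tonelli d (f : 'rV[R]_d.+1 -> \bar R) :
  measurable_fun setT f -> (forall x, 0 <= f x) ->
  \int[leb d.+1]_x f x =
  \int[leb d]_x \int[lebesgue_measure]_t f (cons_row (x, t)).
Proof.
move=> mf f0.
have := ge0_integral_pushforward (@measurable_cons_row R d)
  (leb d \x @lebesgue_measure R) measurableT mf (fun y _ => f0 y).
rewrite preimage_setT fubini_tonelli1//=.
by apply: measurableT_comp => //; exact: measurable_cons_row.
Qed.

Lemma lebesgue_shift1 (v : R) (f : measurableTypeR R -> \bar R) :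
  measurable_fun setT f -> (forall x, 0 <= f x) ->
  \int[lebesgue_measure]_t f (t + v)%R = \int[lebesgue_measure]_t f t.
Proof.
move=> mf f0.
have mv : measurable_fun setT ((fun t => t + v)%R : measurableTypeR R -> measurableTypeR R).
  exact: measurable_funD.
have := ge0_integral_pushforward mv (@lebesgue_measure R) measurableT mf.
rewrite preimage_setT /= => <- //.
apply: eq_measure_integral => A mA _; apply/esym.
apply: lebesgue_measure_unique => //= _ [[a b]] _ <-.
rewrite /pushforward.
have -> : (fun t => t + v)%R @^-1` [set` `]a, b] ] = [set` `](a - v), (b - v)]]%R.
  by apply/seteqP; split => t /=; rewrite !in_itv/= ltrBlDr lerBrDr.
rewrite !lebesgue_measure_itv/= !lte_fin ltrD2r; case: ifP => // _.
by rewrite -!EFinB; congr (_%:E); ring.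
Qed.

(** By induction on the dimension: Tonelli splits off the first coordinate,
    and the translation splits into one on the line and one in dimension [d]. *)
Lemma lebesgue_shift d (v : 'rV[R]_d) (f : 'rV[R]_d -> \bar R) :
  measurable_fun setT f -> (forall x, 0 <= f x) ->
  \int[leb d]_x f (x + v)%R = \int[leb d]_x f x.
Proof.
elim: d v f => [|d IH] v f mf f0.
  by congr integral; apply/funext => x; congr f; apply/rowP; case.
rewrite !lebesgue_tonelli//; last first.
  apply: measurableT_comp => //; exact: measurable_row_add.
pose w : 'rV[R]_d := (\row_j v 0 (lift ord0 j))%R.
have consD x t : (cons_row (x, t) + v = cons_row (x + w, t + v 0%R ord0))%R.
  apply/rowP => i; rewrite !mxE; case: splitP => j ij; rewrite !mxE.
    rewrite ord1/= !mulr1n; congr (_ + v _ _)%R.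
    by apply/val_inj => /=; rewrite ij ord1.
  by congr (_ + v _ _)%R; apply/val_inj.
pose g x := \int[lebesgue_measure]_t f (cons_row (x, t)).
transitivity (\int[leb d]_x g (x + w)%R); last first.
  rewrite IH//.
    apply: (measurable_fun_fubini_tonelli_F (m2 := lebesgue_measure)
      (f \o @cons_row R d)) => //=.
    by apply: measurableT_comp => //; exact: measurable_cons_row.
  by move=> x; exact: integral_ge0.
apply: eq_integral => x _; under eq_integral do rewrite consD.
rewrite (@lebesgue_shift1 _ (fun t => f (cons_row ((x + w)%R, t))))//.
apply: (measurableT_comp mf);
  apply: (measurableT_comp (@measurable_cons_row R d)).
exact: measurable_fun_pair.
Qed.

Lemma lebesgue_shift_signed d (v : 'rV[R]_d) (f : 'rV[R]_d -> \bar R) :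
  measurable_fun setT f ->
  \int[leb d]_x f (x + v)%R = \int[leb d]_x f x.
Proof.
move=> mf; rewrite integralE [RHS]integralE; congr (_ - _).
- rewrite -[RHS](lebesgue_shift v (measurable_funepos mf)).
    by apply: eq_integral => x _; rewrite !funeposE.
  by move=> x; exact: funepos_ge0.
- rewrite -[RHS](lebesgue_shift v (measurable_funeneg mf)).
    by apply: eq_integral => x _; rewrite !funenegE.
  by move=> x; exact: funeneg_ge0.
Qed.

Lemma lebesgue_prod d (f : 'I_d -> R -> R) :
  (forall i, measurable_fun setT (f i)) -> (forall i t, (0 <= f i t)%R) ->
  (forall i, \int[lebesgue_measure]_t (f i t)%:E = 1) ->
  \int[leb d]_x (\prod_(i < d) f i (x 0%R i))%:E = 1.
Proof.
elim: d f => [|d IH] f mf f0 f1.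
  under eq_integral do rewrite big_ord0.
  have l0 : leb 0 setT = 1 by rewrite /leb /= diracE mem_set.
  transitivity (1 * leb 0 setT); last by rewrite l0 mule1.
  exact: integral_cst.
rewrite lebesgue_tonelli; last 2 first.
  - by apply/measurable_EFinP; exact: measurable_row_prod.
  - by move=> x; rewrite lee_fin prodr_ge0.
rewrite -[RHS](IH (fun i => f (lift ord0 i)))//.
apply: eq_integral => x _.
under eq_integral.
  move=> t _; rewrite big_ord_recl.
  have -> : cons_row (x, t) 0%R ord0 = t.
    by rewrite mxE; case: splitP => // j _; rewrite ord1 mxE.
  under eq_bigr => i _.
    have -> : cons_row (x, t) 0%R (lift ord0 i) = x 0%R i.
      rewrite mxE; case: splitP => [j|j /= /eqP]; first by rewrite ord1.
      by rewrite /bump leq0n eqn_add2l => /eqP /val_inj ->.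
    over.
  rewrite EFinM; over.
rewrite /= ge0_integralZr//= ?f1 ?mul1e//.
- by apply/measurable_EFinP; exact: mf.
- by move=> t _; rewrite lee_fin.
- by rewrite lee_fin prodr_ge0.
Qed.

End lebesgue.

Arguments leb {R} d.
Arguments cube {R d} M.

Lemma lebesgue_reflect1 (R : realType) (c : R) (f : measurableTypeR R -> \bar R) :
  measurable_fun setT f -> (forall x, 0 <= f x)%E ->
  (\int[lebesgue_measure]_t f (c - t)%R = \int[lebesgue_measure]_t f t)%E.
Proof.
move=> mf f0.
have mN : measurable_fun setT (-%R : measurableTypeR R -> measurableTypeR R) by [].
have mcf : measurable_fun setT (fun t : measurableTypeR R => f (c + t)).
  by apply: measurableT_comp => //; exact: measurable_funD.
have := ge0_integral_pushforward mN (@lebesgue_measure R) measurableT mcf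
  (fun y _ => f0 (c + y)).
rewrite preimage_setT /= => <-.
rewrite -(@lebesgue_shift1 _ c f)//.
under [RHS]eq_integral do rewrite addrC.
by apply: eq_measure_integral => A mA _; exact: lebesgue_measureN.
Qed.

(** * B-splines on the line *)

Section splines.
Context {R : realType} (L : R) (L0 : 0 < L).
Local Notation mu := (@lebesgue_measure R).

(** Convolution with the uniform probability density on [[0, L]]. *)
Definition avg (b : R -> R) (s : R) : R :=
  L^-1 * \int[mu]_(t in `[0, L]) b (s - t).

(** The B-spline of degree [k] with knots [0, L, .., (k + 1) L], scaled to have
    integral one. Defining it by its recursion is enough: no piecewise
    polynomial formula enters the argument. *)
Definition spl (k : nat) : R -> R :=
  iter k avg (fun t => L^-1 * \1_(`[0, L]%classic) t).

Lemma lebesgue_itv0L : mu `[0, L]%classic = L%:E.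
Proof. by rewrite lebesgue_measure_itv/= lte_fin L0 sube0. Qed.

Lemma integral_indic_itv0L : (\int[mu]_t (\1_(`[0, L]%classic) t)%:E)%E = L%:E.
Proof. by rewrite integral_indic//= setIT; exact: lebesgue_itv0L. Qed.

Lemma avg_EFin (b : R -> R) s : measurable_fun setT b ->
  (forall t, 0 <= b t <= L^-1) ->
  (avg b s)%:E = (L^-1%:E * \int[mu]_(t in `[0%R, L]) (b (s - t))%:E)%E.
Proof.
move=> mb b01; rewrite /avg EFinM /Rintegral fineK//.
apply: integrable_fin_num => //=; apply: measurable_bounded_integrable => //.
- by rewrite /= lebesgue_itv0L ltry.
- apply: measurable_funTS; apply: measurableT_comp => //.
  exact: measurable_funB.
- exists L^-1; split; first exact: num_real.
  move=> M ltM t _ /=; have /andP[b0 b1] := b01 (s - t).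
  by rewrite ger0_norm// (le_trans b1)// ltW.
Qed.

(** The properties of a probability density that survive averaging, the
    width [a] of the support growing by [L] each time. *)
Definition is_bump (a : R) (b : R -> R) := [/\ measurable_fun setT b,
  forall t, 0 <= b t <= L^-1,
  forall t, b t != 0 -> 0 <= t <= a &
  (\int[mu]_t (b t)%:E)%E = 1%E].

(** The integral is kept by Tonelli, as every translate of [b] has integral
    one; the bound is kept because an average is at most the maximum. *)
Lemma avg_bump a b : is_bump a b -> is_bump (a + L) (avg b).
Proof.
move=> [mb b01 ba b1].
have avgE := avg_EFin _ mb b01.
have mbd : measurable_fun setT (fun p : measurableTypeR R * measurableTypeR R =>
    b (p.1 - p.2) * \1_(`[0, L]%classic) p.2).
  apply: measurable_funM; first by apply: measurableT_comp => //;
    exact: measurable_funB.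
  by apply: measurableT_comp => //; exact: measurable_indic.
have avgE' s : (avg b s)%:E =
    (L^-1%:E * \int[mu]_t (b (s - t) * \1_(`[0, L]%classic) t)%:E)%E.
  rewrite avgE integral_mkcond; congr (_ * _)%E; apply: eq_integral => t _.
  by rewrite patchE indicE; case: ifPn => _; rewrite ?mulr1 ?mulr0.
have mavg : measurable_fun setT (avg b).
  apply/measurable_EFinP; rewrite (_ : EFin \o _ = fun s =>
     (L^-1%:E * \int[mu]_t (b (s - t) * \1_(`[0, L]%classic) t)%:E)%E); last first.
    by apply/funext => s; rewrite /= avgE'.
  apply: measurable_funeM.
  apply: (measurable_fun_fubini_tonelli_F (m2 := mu)
    (fun p : measurableTypeR R * measurableTypeR R =>
      (b (p.1 - p.2) * \1_(`[0, L]%classic) p.2)%:E)) => //=.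
    by apply/measurable_EFinP.
  by move=> p; rewrite lee_fin mulr_ge0//; have /andP[] := b01 (p.1 - p.2).
have Lge0 : 0 <= L^-1 by rewrite invr_ge0 ltW.
split=> //.
- move=> s; rewrite -!lee_fin avgE; apply/andP; split.
    rewrite mule_ge0 ?lee_fin//; apply: integral_ge0 => t _.
    by rewrite lee_fin; have /andP[] := b01 (s - t).
  rewrite -[leRHS]mule1; apply: lee_wpmul2l; first by rewrite lee_fin.
  apply: (@le_trans _ _ (\int[mu]_(t in `[0%R, L]) (cst L^-1%:E t))%E).
    apply: ge0_le_integral => //.
    - by move=> t _; rewrite lee_fin; have /andP[] := b01 (s - t).
    - apply/measurable_EFinP/measurable_funTS; apply: measurableT_comp => //.
      exact: measurable_funB.
    - by move=> t _; rewrite lee_fin; have /andP[] := b01 (s - t).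
  by rewrite integral_cst//= lebesgue_itv0L -EFinM mulVf ?gt_eqF.
- move=> s; apply: contraNT => sa; rewrite -eqe avgE integral0_eq ?mule0//= =>
  t.
  rewrite in_itv/= => /andP[t0 tL]; congr _%:E; apply: contraNeq sa => /ba.
  by lra.
- under eq_integral do rewrite avgE'.
  pose F (p : measurableTypeR R * measurableTypeR R) : \bar R :=
    (b (p.1 - p.2) * \1_(`[0, L]%classic) p.2)%:E.
  have F0 p : (0 <= F p)%E.
    by rewrite lee_fin mulr_ge0//; have /andP[] := b01 (p.1 - p.2).
  have mF : measurable_fun setT F by apply/measurable_EFinP.
  rewrite ge0_integralZl//=; last first.
  - by move=> s _; apply: integral_ge0 => t _; exact: (F0 (s, t)).
  - exact: (measurable_fun_fubini_tonelli_F (m2 := mu) F).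
  rewrite (@fubini_tonelli _ _ _ _ _ mu mu F)//.
  rewrite (_ : (\int[mu]_y _)%E = L%:E) ?EFinM -?EFinM ?mulVf ?gt_eqF//.
  rewrite -integral_indic_itv0L.
  apply: eq_integral => t _; rewrite /F/=.
  under eq_integral do rewrite EFinM.
  rewrite ge0_integralZr ?lee_fin//=.
  - rewrite (@lebesgue_shift1 _ (- t) (EFin \o b)) ?b1 ?mul1e//.
      by apply/measurable_EFinP.
    by move=> s; rewrite lee_fin; have /andP[] := b01 s.
  - apply/measurable_EFinP; apply: measurableT_comp => //.
    exact: measurable_funB.
  - by move=> s _; rewrite lee_fin; have /andP[] := b01 (s - t).
Qed.

Lemma spl_bump k : is_bump (k.+1%:R * L) (spl k).
Proof.
elim: k => [|k IH]; last by rewrite -natr1 mulrDl mul1r; exact: avg_bump.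
rewrite mul1r; split => /=.
- by apply: measurable_funM => //; exact: measurable_indic.
- by move=> t; rewrite indicE; case: (_ \in _);
  rewrite ?mulr1 ?mulr0 ?lexx invr_ge0 ltW.
- move=> t; rewrite indicE mem_setE in_itv/=; case: (0 <= t <= L) => //.
  by rewrite mulr0 eqxx.
- under eq_integral do rewrite EFinM.
  rewrite ge0_integralZl//=.
  + by rewrite integral_indic_itv0L -EFinM mulVf ?gt_eqF.
  + by apply/measurable_EFinP; exact: measurable_indic.
  + by rewrite lee_fin invr_ge0 ltW.
Qed.

End splines.

(** * Tensor products of B-splines *)

Section tensor.
Context {R : realType} (L : R) (L0 : 0 < L) {d : nat}.
Local Notation mu := (@lebesgue_measure R).
Local Notation Rd := 'rV[R]_d.
Implicit Types (n : 'I_d -> nat) (x z : Rd).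

(** The degrees [n j] vary with the coordinate, because integrating by parts
    in one direction lowers the degree in that direction alone. *)
Definition tspl n x : R := \prod_(j < d) spl L (n j) (x 0 j).

Let bump k := spl_bump L0 k.

Lemma measurable_spl k : measurable_fun setT (spl L k).
Proof. by have [] := bump k. Qed.

Lemma spl_bounds k t : 0 <= spl L k t <= L^-1.
Proof. by have [_ + _ _] := bump k; exact. Qed.

Lemma spl_ge0 k t : 0 <= spl L k t.
Proof. by have /andP[] := spl_bounds k t. Qed.

Lemma measurable_tspl n : measurable_fun setT (tspl n).
Proof.
by apply: (measurable_row_prod (h := fun j => spl L (n j))) => i;
  exact: measurable_spl.
Qed.

Lemma tspl_ge0 n x : 0 <= tspl n x.
Proof. by apply: prodr_ge0 => j _; exact: spl_ge0. Qed.

Lemma tspl_le n x : tspl n x <= L^-1 ^+ d.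
Proof.
rewrite -[d in leRHS]card_ord -prodr_const; apply: ler_prod => j _.
exact: spl_bounds.
Qed.

Lemma tspl_supp n k x : (forall j, n j <= k)%N -> tspl n x != 0 ->
  forall j, 0 <= x 0 j <= k.+1%:R * L.
Proof.
move=> nk /prodf_neq0 nx j.
have [_ _ /(_ _ (nx j isT)) /andP[-> xn] _] := bump (n j).
by rewrite (le_trans xn)// ler_wpM2r ?ler_nat ?ltnS// ltW.
Qed.

Lemma integral_tspl_sub n z :
  (\int[leb d]_x (tspl n (x - z))%:E = 1)%E.
Proof.
rewrite (@lebesgue_shift _ _ (- z) (EFin \o tspl n))//.
- apply: (@lebesgue_prod _ _ (fun j => spl L (n j))); first by move=> i;
  exact: measurable_spl.
    by move=> i t; exact: spl_ge0.
  by move=> i; have [] := bump (n i).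
- by apply/measurable_EFinP; exact: measurable_tspl.
- by move=> x; rewrite lee_fin tspl_ge0.
Qed.

Lemma integral_tspl_sub_r n z :
  (\int[leb d]_x (tspl n (z - x))%:E = 1)%E.
Proof.
under eq_integral.
  move=> x _; rewrite /tspl; under eq_bigr do rewrite !mxE.
  over.
rewrite /=; apply: (@lebesgue_prod _ _ (fun j t => spl L (n j) (z 0 j - t))).
- move=> i; apply: measurableT_comp; first exact: measurable_spl.
  exact: measurable_funB.
- by move=> i t; exact: spl_ge0.
- move=> i; rewrite (@lebesgue_reflect1 _ _ (EFin \o spl L (n i))).
  + by have [] := bump (n i).
  + by apply/measurable_EFinP; exact: measurable_spl.
  + by move=> t; rewrite lee_fin spl_ge0.
Qed.

Definition evec (i : 'I_d) : Rd := delta_mx 0 i.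

(** Raising the degree in direction [i] amounts to averaging over a segment in
    that direction. This is the form on which integration by parts acts. *)
Lemma tspl_avg n i x :
  ((tspl (fun j => (j == i) + n j)%N x)%:E =
   L^-1%:E * \int[mu]_(t in `[0%R, L]) (tspl n (x - t *: evec i))%:E)%E.
Proof.
have splS k : spl L k.+1 = avg L (spl L k) by [].
rewrite /tspl (bigD1 i)//= eqxx add1n splS.
rewrite (eq_bigr (fun j => spl L (n j) (x 0 j))); last first.
  by move=> j /negbTE ->.
set p := \prod_(_ < d | _) _.
have p0 : 0 <= p by apply: prodr_ge0 => j _; exact: spl_ge0.
rewrite EFinM (avg_EFin L0); last 2 first.
- exact: measurable_spl.
- exact: spl_bounds.
rewrite -muleA; congr (_ * _)%E; rewrite -ge0_integralZr//; last 2 first.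
- apply/measurable_EFinP; apply: measurable_funTS; apply: measurableT_comp.
    exact: measurable_spl.
  exact: measurable_funB.
- by move=> t _; rewrite lee_fin spl_ge0.
apply: eq_integral => t _; rewrite -EFinM; congr _%:E.
rewrite [RHS](bigD1 i)//= !mxE !eqxx mulr1; congr (_ * _).
apply: eq_bigr => j ji.
by rewrite !mxE eqxx/= (negbTE ji) mulr0 subr0.
Qed.

End tensor.

(** * Integrability and integration along lines *)

Section analysis.
Context {R : realType} {d : nat}.
Local Notation mu := (@lebesgue_measure R).
Local Notation Rd := 'rV[R]_d.

Lemma integrable_bounded_support d0 (T : measurableType d0)
    (m : {measure set T -> \bar R}) (f : T -> R) (D : set T) (C : R) :
  measurable D -> (m D < +oo)%E -> measurable_fun setT f ->
  (forall x, f x != 0 -> D x) -> (forall x, D x -> `|f x| <= C) ->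
  m.-integrable setT (EFin \o f).
Proof.
move=> mD mDoo mf fD fC.
have : m.-integrable D (EFin \o f).
  apply: measurable_bounded_integrable => //; first exact: measurable_funTS.
  exists C; split; first exact: num_real.
  by move=> M ltM t Dt /=; rewrite (le_trans (fC _ Dt))// ltW.
move/(integrable_mkcond _ mD); congr (_.-integrable _ _).
apply/funext => x; rewrite patchE; case: ifPn => // /negP xD; apply/esym/eqP.
by rewrite eqe; apply: contra_notT xD => /fD; rewrite inE.
Qed.

Lemma compact_cube (r : R) : compact (cube r : set Rd).
Proof.
apply: (@rV_compact _ _ (fun=> `[- r, r]%classic)) => _.
exact: segment_compact.
Qed.

Lemma continuous_cube_bounded (h : Rd -> R) (r : R) : continuous h ->
  exists C, forall x, cube r x -> `|h x| <= C.
Proof.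
move=> ch.
have /compact_bounded[M [_ hM]] :=
  continuous_compact (continuous_subspaceT ch) (@compact_cube r).
by exists (M + 1) => x rx; apply: (hM (M + 1)); [rewrite ltrDl|exists x].
Qed.

Lemma continuous_line (f : Rd -> R) (x v : Rd) : continuous f ->
  continuous (fun t : R => f (x + t *: v)).
Proof.
move=> cf t.
have ct : (fun s : R => x + s *: v) @ t --> x + t *: v.
  by apply: cvgD; [exact: cvg_cst|exact: scalel_continuous].
exact: (cvg_comp _ _ ct (cf _)).
Qed.

(** The function [t |-> f (x + t e_i)] has the same difference quotients as [f]
    has in direction [e_i]. *)
Lemma FTC_line (f : Rd -> R) (i : 'I_d) (x : Rd) (L : R) : 0 < L ->
  continuous f -> (forall y, derivable f y (delta_mx 0 i)) ->
  continuous (partial i f) ->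
  (\int[mu]_(t in `[0%R, L]) (partial i f (x + t *: evec i))%:E =
   (f (x + L *: evec i))%:E - (f x)%:E)%E.
Proof.
move=> L0 cf df cdf.
pose F t := f (x + t *: evec i).
have dF t : derivable F t 1 /\ 'D_1 F t = partial i f (x + t *: evec i).
  have /= E : (fun h => h^-1 *: ((F \o shift t) (h *: 1) - F t)) =
      (fun h => h^-1 *: ((f \o shift (x + t *: evec i)) (h *: evec i)
        - f (x + t *: evec i))).
    apply/funext => h; rewrite /F/=; congr (_ *: (f _ - _)).
    by rewrite [h%:A]mulr1 scalerDl addrCA.
  split; first by rewrite /derivable E; exact: df.
  by rewrite /derive E.
have cF : continuous F by exact: continuous_line.
rewrite (@continuous_FTC2 _ _ F)//.
- by rewrite /F scale0r addr0.
- by apply: continuous_subspaceT; exact: continuous_line.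
- split; first by move=> t _; have [] := dF t.
    by apply: cvg_at_right_filter; exact: cF.
  by apply: cvg_at_left_filter; exact: cF.
- by move=> t _; rewrite derive1E; have [] := dF t.
Qed.

End analysis.

(** * Pairing a function with the translates of a spline *)

Section pairing.
Context {R : realType} (L : R) (L0 : 0 < L) {d : nat}.
Local Notation mu := (@lebesgue_measure R).
Local Notation Rd := 'rV[R]_d.
Implicit Types (n : 'I_d -> nat) (f h : Rd -> R) (x z : Rd).

(** As a function of [z] this is the correlation of [h] with the spline; for
    nonnegative [h] it is the density of [h] after smoothing by the reflected
    spline. *)
Definition pairing h n z : \bar R :=
  (\int[leb d]_x (h x * tspl L n (x - z))%:E)%E.

Lemma cube_shift (M r : R) x z : (forall j, `|(x - z) 0 j| <= M) ->
  \sum_j `|z 0 j| + M <= r -> cube r x.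
Proof.
move=> xz Mr j /=; rewrite in_itv/= -ler_norml.
apply: le_trans Mr; rewrite -[x](subrK z) mxE (le_trans (ler_normD _ _))//.
rewrite addrC lerD// (bigD1 j)//= lerDl; exact: sumr_ge0.
Qed.

Lemma tspl_supp_norm n k x : (forall j, n j <= k)%N -> tspl L n x != 0 ->
  forall j, `|x 0 j| <= k.+1%:R * L.
Proof.
by move=> nk nx j; have /andP[x0] := tspl_supp L0 nk nx j; rewrite ger0_norm.
Qed.

Lemma measurable_tspl_sub n z : measurable_fun setT (fun x => tspl L n (x - z)).
Proof.
apply: measurableT_comp; first exact: measurable_tspl.
exact: measurable_row_sub.
Qed.

Lemma order_bounded n : exists k, forall j, (n j <= k)%N.
Proof. by exists (\max_j n j) => j; exact: leq_bigmax. Qed.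

Lemma integrable_pairing h n z : continuous h ->
  (leb d).-integrable setT (fun x => (h x * tspl L n (x - z))%:E).
Proof.
move=> ch; have [k nk] := order_bounded n.
pose r := \sum_j `|z 0 j| + k.+1%:R * L.
have [C hC] := continuous_cube_bounded r ch.
apply: (@integrable_bounded_support _ _ _ _ _ (cube r) (C * L^-1 ^+ d)).
- exact: measurable_cube.
- exact: lebesgue_cube_lty.
- apply: measurable_funM; last exact: measurable_tspl_sub.
  exact: measurable_row_continuous.
- move=> x; rewrite mulf_eq0 negb_or => /andP[_ nx].
  by apply: cube_shift (lexx _); exact: tspl_supp_norm nk nx.
- move=> x rx; rewrite normrM ler_pM// ?hC// ger0_norm ?tspl_ge0//.
  exact: tspl_le.
Qed.

Lemma pairing_fin_num h n z : continuous h -> pairing h n z \is a fin_num.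
Proof. by move=> ch; apply: integrable_fin_num => //;
  exact: integrable_pairing. Qed.

Lemma measurable_pairing h n : continuous h -> (forall x, 0 <= h x) ->
  measurable_fun setT (pairing h n).
Proof.
move=> ch h0.
apply: (measurable_fun_fubini_tonelli_G (m1 := leb d)
  (fun p : Rd * Rd => (h p.1 * tspl L n (p.1 - p.2))%:E)) => //=.
  apply/measurable_EFinP; apply: measurable_funM.
    by apply: measurableT_comp => //; exact: measurable_row_continuous.
  apply: measurableT_comp; first exact: measurable_tspl.
  exact: measurable_row_sub.
by move=> p; rewrite lee_fin mulr_ge0// tspl_ge0.
Qed.

Lemma integral_spl0 (c : R) (g : R -> R) :
  mu.-integrable `[0, L] (EFin \o g) ->
  (\int[mu]_t (c * g t * spl L 0 t)%:E =
   c%:E * (L^-1%:E * \int[mu]_(t in `[0%R, L]) (g t)%:E))%E.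
Proof.
move=> ig; rewrite muleA -EFinM -integralZl// [RHS]integral_mkcond.
apply: eq_integral => t _; rewrite patchE /spl/= indicE.
by case: (_ \in _); rewrite ?mulr1 ?mulr0// -EFinM mulrAC.
Qed.

(** The average over a segment is handed over from the spline to [h]: exchange
    the two integrals, translate by [t e_i], and exchange them back. *)
Lemma pairing_avg h n i z : continuous h ->
  pairing h (fun j => (j == i) + n j)%N z =
  (\int[leb d]_x ((tspl L n (x - z))%:E *
    (L^-1%:E * \int[mu]_(t in `[0%R, L]) (h (x + t *: evec i))%:E)))%E.
Proof.
move=> ch; have [k nk] := order_bounded n.
pose I01 := spl L 0.
(* The integrands before and after the translation; [I01] is [L^-1] on
   [[0, L]], so that all integrals run over the whole space. *)
pose F (p : Rd * measurableTypeR R) : R :=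
  h p.1 * tspl L n (p.1 - p.2 *: evec i - z) * I01 p.2.
pose G (p : Rd * measurableTypeR R) : R :=
  h (p.1 + p.2 *: evec i) * tspl L n (p.1 - z) * I01 p.2.
have mscale : measurable_fun setT (fun p : Rd * measurableTypeR R =>
    (p.2 : R) *: evec i) by exact: measurable_row_scale.
have mI01 : measurable_fun setT (fun p : Rd * measurableTypeR R => I01 p.2).
  by apply: measurableT_comp => //; exact: measurable_spl.
have mh : measurable_fun setT h by exact: measurable_row_continuous.
have mt : measurable_fun setT (tspl L n) by exact: measurable_tspl.
have mF : measurable_fun setT F.
  apply: measurable_funM => //; apply: measurable_funM.
    exact: measurableT_comp.
  apply: measurableT_comp => //; apply: measurable_row_sub => //.
  exact: measurable_row_sub.
have mG : measurable_fun setT G.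
  apply: measurable_funM => //; apply: measurable_funM.
    by apply: measurableT_comp => //; exact: measurable_row_add.
  by apply: measurableT_comp => //; exact: measurable_row_sub.
pose r := \sum_j `|z 0 j| + k.+2%:R * L.
have [C hC] := continuous_cube_bounded r ch.
have C0 : 0 <= C.
  apply: le_trans (hC 0 _) => // j /=.
  have r0 : 0 <= r by rewrite addr_ge0 ?sumr_ge0// mulr_ge0// ltW.
  by rewrite mxE in_itv/= oppr_le0 r0.
have kL : k.+2%:R * L = k.+1%:R * L + L by rewrite -natr1 mulrDl mul1r.
have evecN t j : 0 <= t <= L -> `|(t *: evec i) 0 j| <= L.
  move=> /andP[t0 tL]; rewrite !mxE eqxx/=; case: (j == i); last first.
    by rewrite mulr0 normr0 ltW.
  by rewrite mulr1 ger0_norm.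
have I01E t : I01 t != 0 -> 0 <= t <= L.
  by have [_ _ /(_ t)] := spl_bump L0 0; rewrite mul1r.
pose D : set (Rd * measurableTypeR R) := cube r `*` `[0%R, L]%classic.
have D_lty : ((leb d \x mu) D < +oo)%E.
  rewrite product_measure1E//; last exact: measurable_cube.
  apply: lte_mul_pinfty; first exact: measure_ge0.
    rewrite ge0_fin_numE; first exact: lebesgue_cube_lty.
    exact: measure_ge0.
  by apply: le_lt_trans (ltry L); rewrite -(lebesgue_itv0L L0).
have mD : measurable D.
  by apply: measurableX => //; exact: measurable_cube.
have I01le t : `|I01 t| <= L^-1.
  by rewrite ger0_norm ?spl_ge0//; have /andP[] := spl_bounds L0 0 t.
have tle x : `|tspl L n x| <= L^-1 ^+ d.
  by rewrite ger0_norm ?tspl_ge0// tspl_le.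
have L0d : 0 <= L^-1 ^+ d by rewrite exprn_ge0// invr_ge0 ltW.
have Lge0 : 0 <= L^-1 by rewrite invr_ge0 ltW.
have iF : (leb d \x mu)%E.-integrable setT (EFin \o F).
  apply: (integrable_bounded_support (m := (leb d \x mu)%E) (f := F) (D := D)
    (C := C * L^-1 ^+ d * L^-1)) => //.
  - move=> [x t]; rewrite /F/= mulf_eq0 negb_or mulf_eq0 negb_or =>
    /andP[/andP[_ nx] /I01E It].
    split => //; apply: (@cube_shift (k.+2%:R * L) _ _ z) => // j.
    have := tspl_supp_norm nk nx j; have := evecN _ j It.
    rewrite !mxE kL => H1 H2.
    have -> : x 0 j - z 0 j = t * (evec i) 0 j + (x 0 j - t * (evec i) 0 j - z 0 j).
      by rewrite !mxE; ring.
    by rewrite (le_trans (ler_normD _ _))// addrC lerD// !mxE.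
  - move=> [x t] [/= rx _]; rewrite /F/= normrM ler_pM// normrM ler_pM//.
    exact: hC.
have iG : (leb d \x mu)%E.-integrable setT (EFin \o G).
  have Gsupp x t : G (x, t) != 0 ->
      [/\ cube r x, 0 <= t <= L & cube r (x + t *: evec i)].
    rewrite /G/= mulf_eq0 negb_or mulf_eq0 negb_or =>
      /andP[/andP[_ nx] /I01E It].
    split => //.
      apply: (@cube_shift (k.+1%:R * L) _ _ z); first exact: tspl_supp_norm.
      by rewrite /r kL addrA lerDl ltW.
    apply: (@cube_shift (k.+2%:R * L) _ _ z) => // j.
    have := tspl_supp_norm nk nx j; have := evecN _ j It.
    rewrite !mxE kL => H1 H2.
    by rewrite addrAC (le_trans (ler_normD _ _))// lerD// !mxE.
  apply: (integrable_bounded_support (m := (leb d \x mu)%E) (f := G) (D := D)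
    (C := C * L^-1 ^+ d * L^-1)) => //.
  - by move=> [x t] /Gsupp[].
  - move=> [x t] _; have [->|/Gsupp[_ _ xt]] := eqVneq (G (x, t)) 0.
      by rewrite normr0 !mulr_ge0.
    by rewrite /G/= normrM ler_pM// normrM ler_pM// hC.
transitivity (\int[leb d]_x \int[mu]_t (F (x, t))%:E)%E.
  apply: eq_integral => x _.
  rewrite [RHS](integral_spl0 (h x) (g := fun t => tspl L n (x - t *: evec i - z))).
    rewrite EFinM (tspl_avg L0); congr (_ * (_ * _))%E.
    by apply: eq_integral => t _; rewrite addrAC.
  apply: measurable_bounded_integrable => //.
  - by apply: le_lt_trans (ltry L); rewrite -(lebesgue_itv0L L0).
  - apply: measurable_funTS; apply: measurableT_comp => //.
    by apply: measurable_row_sub => //; apply: measurable_row_sub => //;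
      exact: measurable_row_scale.
  - exists (L^-1 ^+ d); split; first exact: num_real.
    by move=> M ltM t _ /=; rewrite (le_trans (tle _))// ltW.
rewrite (Fubini iF).
transitivity (\int[mu]_t \int[leb d]_x (G (x, t))%:E)%E.
  apply: eq_integral => t _.
  rewrite -(@lebesgue_shift_signed _ _ (t *: evec i) (fun x => (F (x, t))%:E)); last first.
    apply/measurable_EFinP; apply: measurableT_comp => //.
  apply: eq_integral => x _; rewrite /F /G/=; congr (h _ * tspl _ _ _ * _)%:E.
  by rewrite addrK.
rewrite -(Fubini iG); apply: eq_integral => x _.
under eq_integral do rewrite /G/= [X in X * _]mulrC.
rewrite [LHS](integral_spl0 (tspl L n (x - z)) (g := fun t => h (x + t *: evec i)))//.
apply: continuous_compact_integrable; first exact: segment_compact.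
by apply: continuous_subspaceT; exact: continuous_line.
Qed.

End pairing.

(** * The smoothed density as a second difference *)

Section ibp.
Context {R : realType} (L : R) (L0 : 0 < L) {d : nat}.
Local Notation mu := (@lebesgue_measure R).
Local Notation Rd := 'rV[R]_d.
Local Notation pair := (pairing L).
Implicit Types (n : 'I_d -> nat) (f h u : Rd -> R) (x z : Rd).

Lemma continuous_shift_row f (v : Rd) : continuous f ->
  continuous (fun x => f (x + v)).
Proof.
move=> cf x; apply: continuous_comp; last exact: cf.
by apply: (@continuousD _ Rd Rd) => //; exact: cst_continuous.
Qed.

(** After the average has been handed over to the derivative of [f], it is an
    average of a derivative along a segment, hence a difference quotient of
    [f]; a translation turns it into a difference quotient of the pairing. *)
Lemma pairing_ibp f n i z : continuous f ->
  (forall x, derivable f x (delta_mx 0 i)) -> continuous (partial i f) ->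
  pair (partial i f) (fun j => (j == i) + n j)%N z =
  (L^-1%:E * (pair f n (z + L *: evec i) - pair f n z))%E.
Proof.
move=> cf df cdf; rewrite pairing_avg//.
have cfL := continuous_shift_row (v := L *: evec i) cf.
have iL := integrable_pairing L0 n z cfL.
have i0 := integrable_pairing L0 n z cf.
have -> : pair f n (z + L *: evec i) =
    (\int[leb d]_x (f (x + L *: evec i) * tspl L n (x - z))%:E)%E.
  rewrite /pairing -(@lebesgue_shift_signed _ _ (L *: evec i)); last first.
    by have /integrableP[] := integrable_pairing L0 n (z + L *: evec i) cf.
  apply: eq_integral => x _; congr (_ * tspl _ _ _)%:E.
  by rewrite opprD addrACA subrr addr0.
rewrite -integralB// -integralZl//; last exact: integrableB.
apply: eq_integral => x _; rewrite FTC_line//.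
by rewrite -!EFinB -!EFinM; congr _%:E; ring.
Qed.

Lemma pairing_sum (h : 'I_d -> Rd -> R) n z : (forall i, continuous (h i)) ->
  pair (fun x => \sum_i h i x) n z = (\sum_i pair (h i) n z)%E.
Proof.
move=> ch; rewrite /pairing -integral_sum//; last first.
  by move=> i; exact: integrable_pairing.
by apply: eq_integral => x _; rewrite mulr_suml sumEFin.
Qed.

(** The degrees that remain when the two averages in direction [i] are taken
    off the spline which is quadratic in every coordinate. *)
Definition flat i : 'I_d -> nat := fun j => if j == i then 0%N else 2%N.

(** [L^-2] times an average of [u] near [z]. The smoothed density is one plus a
    second difference of it ([pairing_density]), which is why it can serve as
    the jump probability of the random walk below. *)
Definition jump_rate u i z : R := L ^- 2 * fine (pair u (flat i) z).

Lemma continuous_laplacian u : C2_fun u -> continuous (laplacian u).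
Proof.
move=> [_ ddu].
have -> : laplacian u = \sum_i partial i (partial i u).
  by apply/funext => x; rewrite fct_sumE.
elim/big_ind : _ => [|f g cf cg x|i _]; first exact: cst_continuous.
- by apply: (@continuousD _ R Rd) => //; [exact: cf|exact: cg].
- by have [_ /(_ i)[]] := ddu i.
Qed.

(** Each second derivative of [u] meets a spline that is quadratic in its
    direction, and so can be integrated by parts twice; the constant [1]
    contributes the integral of the spline. *)
Lemma pairing_density u z : C2_fun u ->
  pair (fun x => 1 + laplacian u x) (fun=> 2%N) z =
  (1 + \sum_i (jump_rate u i (z + L *: evec i + L *: evec i)
     - 2 * jump_rate u i (z + L *: evec i) + jump_rate u i z))%:E.
Proof.
move=> /[dup] uC2 [[cu du] ddu].
have cp i : continuous (partial i (partial i u)).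
  by have [_ /(_ i)[]] := ddu i.
have clap : continuous (laplacian u) by exact: continuous_laplacian.
have -> : pair (fun x => 1 + laplacian u x) (fun=> 2%N) z =
    (1 + \sum_i pair (partial i (partial i u)) (fun=> 2%N) z)%E.
  rewrite -pairing_sum//.
  rewrite -[X in (X + _)%E](integral_tspl_sub L0 (fun=> 2%N) z) /pairing -integralD//.
  - by apply: eq_integral => x _; rewrite mulrDl mul1r EFinD.
  - have := integrable_pairing L0 (fun=> 2%N) z (@cst_continuous _ _ (1 : R)).
    by under eq_fun do rewrite mul1r.
  - exact: integrable_pairing.
rewrite EFinD -sumEFin; congr (_ + _)%E; apply: eq_bigr => i _.
have [cpu /(_ i)[dpu _]] := ddu i.
have [du1 _] := du i.
have fE (w : Rd) : pair u (flat i) w = (fine (pair u (flat i) w))%:E.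
  by rewrite fineK// pairing_fin_num.
(* Two degrees in direction [i] are used up by the two integrations by parts. *)
have two : (fun=> 2%N) = (fun j => (j == i) + ((j == i) + flat i j))%N.
  by apply/funext => j; rewrite /flat; case: eqP.
rewrite two pairing_ibp// !pairing_ibp//.
rewrite fE (fE (z + L *: evec i)) (fE z).
rewrite -!(EFinB, EFinM) /jump_rate; congr _%:E.
by field; rewrite gt_eqF.
Qed.

(** The spline is a probability density, so the average of [u] lies between
    the bounds of [u]. *)
Lemma jump_rate_bounds u (S : R) i z : continuous u ->
  (forall x, 0 <= u x <= S) -> 0 <= jump_rate u i z <= S / L ^+ 2.
Proof.
move=> cu uS.
have uf := pairing_fin_num L0 (flat i) z cu.
have L2 : 0 <= L ^- 2 by rewrite invr_ge0 exprn_ge0// ltW.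
rewrite /jump_rate mulrC; apply/andP; split.
  rewrite mulr_ge0// fine_ge0//; apply: integral_ge0 => x _.
  by have /andP[u0 _] := uS x; rewrite lee_fin mulr_ge0// tspl_ge0.
apply: ler_wpM2r => //.
rewrite -lee_fin fineK//.
have /= <- : (\int[leb d]_x (S%:E * (tspl L (flat i) (x - z))%:E) = S%:E)%E.
  rewrite ge0_integralZl//= ?integral_tspl_sub ?mule1//.
  - by apply/measurable_EFinP; exact: measurable_tspl_sub.
  - by move=> x _; rewrite lee_fin tspl_ge0.
  - by have /andP[u0] := uS z; rewrite lee_fin; exact: le_trans.
apply: ge0_le_integral => //.
- by move=> x _; rewrite lee_fin mulr_ge0 ?tspl_ge0//; have /andP[] := uS x.
- by have /integrableP[] := integrable_pairing L0 (flat i) z cu.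
- apply/measurable_EFinP/measurable_funM => //; exact: measurable_tspl_sub.
- move=> x _; rewrite lee_fin ler_wpM2r ?tspl_ge0//.
  by have /andP[] := uS x.
Qed.

Lemma measurable_jump_rate u i : continuous u -> (forall x, 0 <= u x) ->
  measurable_fun setT (jump_rate u i).
Proof.
move=> cu u0; apply: measurable_funM => //.
apply: measurableT_comp => //; exact: measurable_pairing.
Qed.

End ibp.

(** * Measures with a density and composition of plans *)

(** The positive and the negative part of [f] are transferred separately. *)
Lemma integral_marginal (R : realType) d1 d2 (T1 : measurableType d1)
    (T2 : measurableType d2) (g : T1 -> T2) (m1 : {measure set T1 -> \bar R})
    (m2 : {measure set T2 -> \bar R}) (f : T2 -> \bar R) :
  measurable_fun setT g -> measurable_fun setT f ->
  (forall A, measurable A -> m1 (g @^-1` A) = m2 A) ->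
  (\int[m1]_x f (g x) = \int[m2]_y f y)%E.
Proof.
move=> mg mf m12.
have ge0E (k : T2 -> \bar R) : measurable_fun setT k ->
  (forall y, (0 <= k y)%E) ->
    (\int[m1]_x k (g x) = \int[m2]_y k y)%E.
  move=> mk k0.
  have := ge0_integral_pushforward mg m1 measurableT mk (fun y _ => k0 y).
  rewrite preimage_setT /= => <-.
  by apply: eq_measure_integral => A mA _; exact: m12.
rewrite integralE [RHS]integralE; congr (_ - _)%E.
- rewrite -(ge0E _ (measurable_funepos mf)); last by move=> y;
  exact: funepos_ge0.
  by apply: eq_integral => x _; rewrite !funeposE.
- rewrite -(ge0E _ (measurable_funeneg mf)); last by move=> y;
  exact: funeneg_ge0.
  by apply: eq_integral => x _; rewrite !funenegE.
Qed.

Section density_measure.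
Context {R : realType} d (T : measurableType d) (mu : {measure set T -> \bar R}).
Variables (f : T -> \bar R) (mf : measurable_fun setT f)
  (f0 : forall x, (0 <= f x)%E).

(** The two proofs appear in the body so that the term determines them, which
    lets the measure structure below be inferred from it. *)
Definition density_measure : set T -> \bar R :=
  let _ := mf in let _ := f0 in fun A => (\int[mu]_(x in A) f x)%E.

Let dens_set0 : density_measure set0 = 0%E. Proof. exact: integral_set0. Qed.

Let dens_ge0 A : (0 <= density_measure A)%E.
Proof. by apply: integral_ge0 => x _; exact: f0. Qed.

Let dens_sigma_additive : semi_sigma_additive density_measure.
Proof. exact: semi_sigma_additive_nng_induced. Qed.

HB.instance Definition _ := isMeasure.Build _ _ _ density_measure
  dens_set0 dens_ge0 dens_sigma_additive.

End density_measure.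

Section marginals.
Context {R : realType} d1 d2 (T1 : measurableType d1) (T2 : measurableType d2).
Variables (m1 : {sigma_finite_measure set T1 -> \bar R})
  (m2 : {sigma_finite_measure set T2 -> \bar R}).
Variables (D : T1 * T2 -> \bar R) (mD : measurable_fun setT D)
  (D0 : forall p, (0 <= D p)%E).
Local Notation gamma := (density_measure (m1 \x m2)%E mD D0).

Lemma density_measure_fst A : measurable A ->
  (gamma (fst @^-1` A) = \int[m1]_(x in A) \int[m2]_y D (x, y))%E.
Proof.
move=> mA; have mA1 : measurable (fst @^-1` A : set (T1 * T2)).
  by rewrite -[X in measurable X]setTI; exact: measurable_fst.
rewrite /density_measure integral_mkcond fubini_tonelli1; last 2 first.
- by apply/(measurable_restrictT _ mA1); exact: measurable_funTS.
- by move=> p; rewrite patchE; case: ifP.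
rewrite [RHS]integral_mkcond; apply: eq_integral => x _.
rewrite /fubini_F patchE; case: ifPn => xA.
  by apply: eq_integral => y _; rewrite patchE mem_set//; exact: set_mem.
rewrite integral0_eq// => y _; rewrite patchE memNset//=.
by move=> /mem_set; rewrite (negPf xA).
Qed.

Lemma density_measure_snd B : measurable B ->
  (gamma (snd @^-1` B) = \int[m2]_(y in B) \int[m1]_x D (x, y))%E.
Proof.
move=> mB; have mB2 : measurable (snd @^-1` B : set (T1 * T2)).
  by rewrite -[X in measurable X]setTI; exact: measurable_snd.
rewrite /density_measure integral_mkcond fubini_tonelli2; last 2 first.
- by apply/(measurable_restrictT _ mB2); exact: measurable_funTS.
- by move=> p; rewrite patchE; case: ifP.
rewrite [RHS]integral_mkcond; apply: eq_integral => y _.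
rewrite /fubini_G patchE; case: ifPn => yB.
  by apply: eq_integral => x _; rewrite patchE mem_set//; exact: set_mem.
rewrite integral0_eq// => x _; rewrite patchE memNset//=.
by move=> /mem_set; rewrite (negPf yB).
Qed.

End marginals.

Section gluing.
Context {R : realType} d0 (T : measurableType d0)
  (m : {sigma_finite_measure set T -> \bar R}).
Variables (P M : T * T -> R) (N : T -> R).
Hypotheses (mP : measurable_fun setT P) (mM : measurable_fun setT M)
  (mN : measurable_fun setT N).
Hypotheses (P0 : forall p, 0 <= P p) (M0 : forall p, 0 <= M p)
  (N0 : forall z, 0 < N z).
Hypotheses (PN : forall z, (\int[m]_x (P (x, z))%:E = (N z)%:E)%E)
  (MN : forall z, (\int[m]_y (M (z, y))%:E = (N z)%:E)%E).

(** The plan [P] followed by the plan [M], which share the marginal [N]: given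
    the intermediate point [z], the source has density [P (x, z) / N z] and,
    independently, the target has density [M (z, y) / N z]. *)
Definition glued (p : T * T) : \bar R :=
  (\int[m]_z (P (p.1, z) * ((N z)^-1 * M (z, p.2)))%:E)%E.

Let W (q : (T * T) * T) : R := P (q.1.1, q.2) * ((N q.2)^-1 * M (q.2, q.1.2)).

Let mNV : measurable_fun setT (fun z => (N z)^-1).
Proof.
apply: (@measurable_comp _ _ _ _ _ _ [set t : R | t != 0]) => //.
- by apply: open_measurable; exact: open_neq.
- by move=> _ [z _ <-]; rewrite /= gt_eqF.
- apply: open_continuous_measurable_fun; first exact: open_neq.
  by move=> t /set_mem/= t0; exact: inv_continuous.
Qed.

Let mW : measurable_fun setT W.
Proof.
have m11 : measurable_fun setT (fun q : T * T * T => q.1.1).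
  exact: measurableT_comp.
have m12 : measurable_fun setT (fun q : T * T * T => q.1.2).
  exact: measurableT_comp.
apply: measurable_funM.
  by apply: measurableT_comp => //; exact: measurable_fun_pair.
apply: measurable_funM; first exact: (measurableT_comp mNV measurable_snd).
by apply: measurableT_comp => //; exact: measurable_fun_pair.
Qed.

Let W0 q : 0 <= W q.
Proof. by rewrite mulr_ge0// mulr_ge0// invr_ge0 ltW. Qed.

Lemma measurable_glued : measurable_fun setT glued.
Proof.
apply: (measurable_fun_fubini_tonelli_F (m2 := m) (EFin \o W)).
  exact/measurable_EFinP.
by move=> q; rewrite lee_fin.
Qed.

Lemma glued_ge0 p : (0 <= glued p)%E.
Proof. by apply: integral_ge0 => z _; rewrite lee_fin (W0 (p, z)). Qed.

Let mul_int (a : R) (g : T -> R) : 0 <= a -> measurable_fun setT g ->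
  (forall y, 0 <= g y) ->
  (\int[m]_y (a * g y)%:E = a%:E * \int[m]_y (g y)%:E)%E.
Proof.
move=> a0 mg g0; under eq_integral do rewrite EFinM.
by rewrite ge0_integralZl//;
  [exact/measurable_EFinP|move=> y _; rewrite lee_fin].
Qed.

Let mpairl (g : T * T -> R) x : measurable_fun setT g ->
  measurable_fun setT (fun y => g (x, y)).
Proof. by move=> mg; apply: measurableT_comp => //;
  exact: measurable_fun_pair. Qed.

Let mpairr (g : T * T -> R) y : measurable_fun setT g ->
  measurable_fun setT (fun x => g (x, y)).
Proof. by move=> mg; apply: measurableT_comp => //;
  exact: measurable_fun_pair. Qed.

Lemma glued_fst x :
  (\int[m]_y glued (x, y) = \int[m]_z (P (x, z))%:E)%E.
Proof.
rewrite (fubini_tonelli (fun q : T * T => (W ((x, q.1), q.2))%:E)) /=;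
  last 2 first.
- apply/measurable_EFinP; apply: measurableT_comp => //.
  by apply: measurable_fun_pair => //; exact: measurable_fun_pair.
- by move=> q; rewrite lee_fin.
apply: eq_integral => z _; rewrite /W/=.
under eq_integral do rewrite mulrA.
have Nge : 0 <= (N z)^-1 by rewrite invr_ge0 ltW.
rewrite mul_int ?mulr_ge0//; last exact: mpairl.
by rewrite MN -EFinM divfK// gt_eqF.
Qed.

Lemma glued_snd y :
  (\int[m]_x glued (x, y) = \int[m]_z (M (z, y))%:E)%E.
Proof.
rewrite (fubini_tonelli (fun q : T * T => (W ((q.1, y), q.2))%:E)) /=;
  last 2 first.
- apply/measurable_EFinP; apply: measurableT_comp => //.
  by apply: measurable_fun_pair => //; exact: measurable_fun_pair.
- by move=> q; rewrite lee_fin.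
apply: eq_integral => z _; rewrite /W/=.
under eq_integral do rewrite mulrC.
have Nge : 0 <= (N z)^-1 by rewrite invr_ge0 ltW.
rewrite mul_int ?mulr_ge0//; last exact: mpairr.
by rewrite PN -EFinM mulrAC mulVf ?mul1r// gt_eqF.
Qed.

Lemma glued_neq0 x y : glued (x, y) != 0%E ->
  exists z, P (x, z) != 0 /\ M (z, y) != 0.
Proof.
apply: contra_neqP => PM; apply: integral0_eq => z _ /=; congr _%:E.
have [->|Pz] := eqVneq (P (x, z)) 0; first by rewrite mul0r.
have [->|Mz] := eqVneq (M (z, y)) 0; first by rewrite !mulr0.
by exfalso; apply: PM; exists z.
Qed.

End gluing.

(** * A lazy random walk started from Lebesgue measure *)

Section walk.
Context {R : realType} {d : nat} {I : finType}.
Local Notation Rd := 'rV[R]_d.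
Variables (K : I -> Rd -> R) (v : I -> Rd) (phi : Rd -> R) (kappa : R).
Hypotheses (mK : forall i, measurable_fun setT (K i))
  (K0 : forall i z, 0 <= K i z) (Kle : forall i z, K i z <= kappa)
  (kappa_small : 4 * #|I|%:R * kappa <= 1).
Hypotheses (mphi : measurable_fun setT phi) (phi0 : forall x, 0 <= phi x)
  (phi1 : forall w, (\int[leb d]_y (phi (y - w))%:E = 1)%E)
  (phi1' : forall y, (\int[leb d]_z (phi (y - z))%:E = 1)%E).

Definition stay z : R := 1 - \sum_i 2 * K i (z + v i).

(** The density of the arrival points when the starting points have Lebesgue
    measure, written as one plus a second difference; [smoothedE] collects
    instead the walkers that stay and those that come from either side. *)
Definition smoothed z : R :=
  1 + \sum_i (K i (z + v i + v i) - 2 * K i (z + v i) + K i z).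

(** The joint density of the arrival point [z] and of a point [y] drawn with
    density [phi (y - w)] around the starting point [w]. The walker jumps from
    [w] to [w + v i] and to [w - v i], each with probability [K i (w + v i)].
    So the terms belong to the starting points [w = z], [w = z + v i] and
    [w = z - v i] of the walkers that arrive at [z]. *)
Definition walk (p : Rd * Rd) : R := stay p.1 * phi (p.2 - p.1) +
  \sum_i (K i (p.1 + v i + v i) * phi (p.2 - (p.1 + v i)) +
          K i p.1 * phi (p.2 - (p.1 - v i))).

Lemma stay_ge z : 2^-1 <= stay z.
Proof.
have : \sum_i 2 * K i (z + v i) <= \sum_(i : I) 2 * kappa.
  by apply: ler_sum => i _; rewrite ler_wpM2l.
rewrite sumr_const -[leRHS]mulr_natl -/(#|I|) => H.
by move: kappa_small; rewrite /stay; lra.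
Qed.

Lemma stay_ge0 z : 0 <= stay z.
Proof. by apply: le_trans (stay_ge z). Qed.

Lemma smoothedE z : smoothed z = stay z + \sum_i (K i (z + v i + v i) + K i z).
Proof.
rewrite /smoothed /stay -addrA; congr (_ + _).
rewrite -sumrN -big_split/=; apply: eq_bigr => i _; ring.
Qed.

Lemma smoothed_gt0 z : 0 < smoothed z.
Proof.
rewrite smoothedE ltr_pwDl//; first by rewrite (lt_le_trans _ (stay_ge z)).
by apply: sumr_ge0 => i _; rewrite addr_ge0.
Qed.

Lemma measurable_K_shift i (w : Rd) :
  measurable_fun setT (fun z : Rd => K i (z + w)).
Proof. by apply: measurableT_comp => //; exact: measurable_row_add. Qed.

Lemma measurable_phi_shift (w : Rd) :
  measurable_fun setT (fun y : Rd => phi (y - w)).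
Proof. by apply: measurableT_comp => //; exact: measurable_row_sub. Qed.

Lemma measurable_phi_reflect (y w : Rd) :
  measurable_fun setT (fun z : Rd => phi (y - (z + w))).
Proof.
apply: measurableT_comp => //; apply: measurable_row_sub => //.
exact: measurable_row_add.
Qed.

Lemma measurable_stay : measurable_fun setT stay.
Proof.
apply: measurable_funB => //; apply: measurable_sum => i.
by apply: measurable_funM => //; exact: measurable_K_shift.
Qed.

Lemma measurable_smoothed : measurable_fun setT smoothed.
Proof.
apply: measurable_funD => //; apply: measurable_sum => i.
have mKvv : measurable_fun setT (fun z : Rd => K i (z + v i + v i)).
  by under eq_fun do rewrite -addrA; exact: measurable_K_shift.
apply: measurable_funD => //; apply: measurable_funB => //.
by apply: measurable_funM => //; exact: measurable_K_shift.
Qed.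

Lemma measurable_walk : measurable_fun setT walk.
Proof.
have m1 (w : Rd) : measurable_fun setT (fun p : Rd * Rd => p.1 + w).
  exact: measurable_row_add.
have mp (w : Rd) :
  measurable_fun setT (fun p : Rd * Rd => phi (p.2 - (p.1 + w))).
  by apply: measurableT_comp => //; exact: measurable_row_sub.
apply: measurable_funD.
  apply: measurable_funM.
    by apply: measurableT_comp => //; exact: measurable_stay.
  by apply: measurableT_comp => //; exact: measurable_row_sub.
apply: measurable_sum => i; apply: measurable_funD;
  apply: measurable_funM => //.
  apply: measurableT_comp => //; exact: measurable_row_add.
exact: measurableT_comp.
Qed.

Lemma walk_ge0 p : 0 <= walk p.
Proof.
rewrite addr_ge0 ?mulr_ge0 ?sumr_ge0 ?stay_ge0// => i _.
by rewrite addr_ge0// mulr_ge0.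
Qed.

Lemma integral_walk_r z : (\int[leb d]_y (walk (z, y))%:E = (smoothed z)%:E)%E.
Proof.
have mcphi (c : R) (w : Rd) :
  measurable_fun setT (fun y : Rd => (c * phi (y - w))%:E).
  apply/measurable_EFinP/measurable_funM => //; exact: measurable_phi_shift.
have cphi (c : R) (w : Rd) : 0 <= c ->
  (\int[leb d]_y (c * phi (y - w))%:E = c%:E)%E.
  move=> c0; under eq_integral do rewrite EFinM.
  rewrite ge0_integralZl//= ?phi1 ?mule1//.
  - by apply/measurable_EFinP; exact: measurable_phi_shift.
  - by move=> y _; rewrite lee_fin.
have c0phi (c : R) (w y : Rd) : 0 <= c -> (0 <= (c * phi (y - w))%:E)%E.
  by move=> c0; rewrite lee_fin mulr_ge0.
rewrite smoothedE /walk/=.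
under eq_integral => y _.
  rewrite EFinD -sumEFin.
  under eq_bigr do rewrite EFinD.
  over.
rewrite ge0_integralD//=; last 3 first.
- by move=> y _; apply: c0phi; exact: stay_ge0.
- by move=> y _; apply: sume_ge0 => i _; rewrite adde_ge0// c0phi.
- by apply: emeasurable_sum => i; exact: emeasurable_funD.
rewrite cphi ?stay_ge0// ge0_integral_sum//=; last 2 first.
- by move=> i; exact: emeasurable_funD.
- by move=> i y _; rewrite adde_ge0// c0phi.
rewrite [RHS]EFinD -sumEFin; congr (_ + _)%E; apply: eq_bigr => i _.
rewrite ge0_integralD//= ?cphi//.
- by move=> y _; rewrite c0phi.
- by move=> y _; rewrite c0phi.
Qed.

(** Translating each arrival point back to its starting point [w] turns the
    integral over [z] into one over [w], where the probabilities of staying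
    and of jumping add up to one. *)
Lemma integral_walk_l y : (\int[leb d]_z (walk (z, y))%:E = 1)%E.
Proof.
have mphiy0 : measurable_fun setT (fun z : Rd => phi (y - z)).
  by apply: measurableT_comp => //; exact: measurable_row_sub.
have mKphi i (w w' : Rd) : measurable_fun setT
    (fun z : Rd => (K i (z + w) * phi (y - (z + w')))%:E).
  apply/measurable_EFinP/measurable_funM; first exact: measurable_K_shift.
  exact: measurable_phi_reflect.
have mKphi2 i : measurable_fun setT
    (fun z : Rd => (K i (z + v i + v i) * phi (y - (z + v i)))%:E).
  by have := mKphi i (v i + v i) (v i); under eq_fun do rewrite addrA.
have mKphi0 i (w : Rd) : measurable_fun setT
    (fun z : Rd => (K i z * phi (y - (z + w)))%:E).
  by apply/measurable_EFinP/measurable_funM => //;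
    exact: measurable_phi_reflect.
have mKphi1 i :
  measurable_fun setT (fun z : Rd => (K i (z + v i) * phi (y - z))%:E).
  by apply/measurable_EFinP/measurable_funM => //; exact: measurable_K_shift.
have Kphi0 i (w w' : Rd) : (0 <= (K i w * phi (y - w'))%:E)%E.
  by rewrite lee_fin mulr_ge0.
have mstay : measurable_fun setT (fun z : Rd => (stay z * phi (y - z))%:E).
  by apply/measurable_EFinP/measurable_funM => //; exact: measurable_stay.
pose A i := (\int[leb d]_z (K i (z + v i) * phi (y - z))%:E)%E.
rewrite /walk/=; under eq_integral => z _.
  rewrite EFinD -sumEFin.
  under eq_bigr do rewrite EFinD.
  over.
rewrite ge0_integralD//=; last 3 first.
- by move=> z _; rewrite lee_fin mulr_ge0// stay_ge0.
- by move=> z _; apply: sume_ge0 => i _; rewrite adde_ge0.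
- by apply: emeasurable_sum => i; exact: emeasurable_funD.
rewrite ge0_integral_sum//=; last 2 first.
- by move=> i; exact: emeasurable_funD.
- by move=> i z _; rewrite adde_ge0.
(* Both jumps in direction [i] leave [w] with probability [K i (w + v i)]. *)
rewrite (eq_bigr (fun i => A i + A i)%E) => [|i _]; last first.
  rewrite ge0_integralD//=; congr (_ + _)%E.
    rewrite /A -(@lebesgue_shift _ _ (v i) (fun z : Rd => (K i (z + v i) * phi (y - z))%:E))//.
  rewrite -(@lebesgue_shift _ _ (v i) (fun z : Rd => (K i z * phi (y - (z - v i)))%:E))//.
  by apply: eq_integral => z _; rewrite addrK.
rewrite -(phi1' y).
rewrite (eq_bigr (fun i => \int[leb d]_z
    (2 * K i (z + v i) * phi (y - z))%:E)%E) => [|i _]; last first.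
  rewrite /A -ge0_integralD//=.
  by apply: eq_integral => z _; rewrite -EFinD; congr _%:E; ring.
have m2K i :
  measurable_fun setT (fun z : Rd => (2 * K i (z + v i) * phi (y - z))%:E).
  apply/measurable_EFinP/measurable_funM => //; apply: measurable_funM => //.
  exact: measurable_K_shift.
rewrite -ge0_integral_sum//=; last first.
  by move=> i z _; rewrite lee_fin !mulr_ge0.
rewrite -ge0_integralD//=; last 3 first.
- by move=> z _; rewrite lee_fin mulr_ge0// stay_ge0.
- by move=> z _; apply: sume_ge0 => i _; rewrite lee_fin !mulr_ge0.
- exact: emeasurable_sum.
apply: eq_integral => z _; rewrite sumEFin -EFinD; congr _%:E.
by rewrite -mulr_suml -mulrDl /stay subrK mul1r.
Qed.

Lemma walk_neq0 z y : walk (z, y) != 0 ->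
  phi (y - z) != 0 \/
  exists i, phi (y - (z + v i)) != 0 \/ phi (y - (z - v i)) != 0.
Proof.
apply: contra_neqP => /not_orP[/negP/negPn/eqP z0 /forallNP zi].
rewrite /walk/= z0 mulr0 add0r big1// => i _.
by have /not_orP[/negP/negPn/eqP -> /negP/negPn/eqP ->] :=
  zi i; rewrite !mulr0 addr0.
Qed.

End walk.

(** * The density of the measure *)

Section bounded_sets.
Context {R : realType} {d : nat}.
Local Notation Rd := 'rV[R]_d.

Lemma bounded_cube (r : R) : bounded_set (cube r : set Rd).
Proof. exact: (compact_bounded (@compact_cube R d r)). Qed.

Lemma bounded_fst_cube (A : set (Rd * Rd)) : bounded_set A ->
  exists r, A `<=` fst @^-1` cube r.
Proof.
move=> [M [_ hM]]; exists (M + 2) => z Az.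
have zM : `|z| < M + 2.
  by apply: le_lt_trans (hM (M + 1) _ z Az) _; rewrite ?ltrDl// ltrD2l ltr1n.
have : ball (0 : Rd * Rd) (M + 2) z
  by rewrite prod_norm_ball /ball_/= sub0r normrN.
move=> [/= [_ + _]] i =>
  /(_ 0 i); rewrite /ball/= mxE sub0r normrN in_itv/= => H.
by rewrite -ler_norml ltW.
Qed.

Lemma integrable_continuous_cube (A : set Rd) (r : R) (f : Rd -> R) :
  measurable A -> A `<=` cube r -> continuous f ->
  (leb d).-integrable A (EFin \o f).
Proof.
move=> mA Ar cf; have [C hC] := continuous_cube_bounded r cf.
apply: measurable_bounded_integrable => //.
- apply: le_lt_trans (lebesgue_cube_lty d r).
  by apply: le_measure; rewrite ?inE//; exact: measurable_cube.
- by apply: measurable_funTS; exact: measurable_row_continuous.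
- exists C; split; first exact: num_real.
  by move=> M ltM x Ax /=; rewrite (le_trans (hC _ (Ar _ Ax)))// ltW.
Qed.

Lemma open_coord_gt (r : R) (j : 'I_d) :
  open [set z : Rd * Rd | r < `|z.1 0 j - z.2 0 j|].
Proof.
have c : continuous (fun z : Rd * Rd => `|z.1 0 j - z.2 0 j|).
  move=> z; apply: cvg_norm; apply: cvgB.
    by apply: (@cvg_comp _ _ _ fst (fun x : Rd => x 0 j));
      [exact: cvg_fst|exact: coord_continuous].
  by apply: (@cvg_comp _ _ _ snd (fun x : Rd => x 0 j));
    [exact: cvg_snd|exact: coord_continuous].
by apply: (@open_comp _ _ _ [set t | r < t]) =>
  [z _|]; [exact: c|exact: open_gt].
Qed.

Lemma enorm_le (x : Rd) (r : R) : 0 <= r -> (forall j, `|x 0 j| <= r) ->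
  enorm x <= Num.sqrt d%:R * r.
Proof.
move=> r0 xr; have -> : Num.sqrt d%:R * r = Num.sqrt (d%:R * r ^+ 2).
  by rewrite sqrtrM// sqrtr_sqr ger0_norm.
rewrite ler_wsqrtr// mulr_natl -[d in leRHS]card_ord -sumr_const.
by apply: ler_sum => j _; rewrite -real_normK ?num_real// lerXn2r ?nnegrE.
Qed.

End bounded_sets.

Section density.
Context {R : realType} {d : nat}.
Local Notation Rd := 'rV[R]_d.
Variables (nu : {measure set Rd -> \bar R}) (u : Rd -> R).
Hypotheses (uC2 : C2_fun u)
  (nu_u : diff_has_density nu (lebesgue_rV R d) (laplacian u)).

Definition source_density x : R := 1 + laplacian u x.

Lemma continuous_source_density : continuous source_density.
Proof.
move=> x; apply: (@continuousD _ R Rd); first exact: cst_continuous.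
exact: continuous_laplacian.
Qed.

Let cdens := continuous_source_density.

Let mdens : measurable_fun setT source_density.
Proof. exact: measurable_row_continuous. Qed.

Lemma density_cube (A : set Rd) r : measurable A -> A `<=` cube r ->
  nu A = (\int[leb d]_(x in A) (source_density x)%:E)%E.
Proof.
move=> mA Ar.
have bA : bounded_set A.
  have [M [Mr hM]] := @bounded_cube R d r.
  by exists M; split=> // N MN x /Ar; exact: hM.
have lA : (lebesgue_rV R d A < +oo)%E.
  apply: le_lt_trans (lebesgue_cube_lty d r).
  by apply: le_measure; rewrite ?inE//; exact: measurable_cube.
have lfin : lebesgue_rV R d A \is a fin_num by rewrite ge0_fin_numE.
have ilap : (leb d).-integrable A (EFin \o laplacian u).
  by apply: integrable_continuous_cube mA Ar _; exact: continuous_laplacian.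
have -> : nu A = (lebesgue_rV R d A + (nu A - lebesgue_rV R d A))%E.
  by rewrite addeC subeK.
rewrite nu_u//.
have -> : lebesgue_rV R d A = (\int[leb d]_(x in A) (1%:E : \bar R))%E.
  by rewrite integral_cst// mul1e.
rewrite -integralD//.
apply/integrableP; split; first exact: measurable_cst.
rewrite (eq_integral (fun=> 1%E)) => [|x _]; last by rewrite /= normr1.
by rewrite integral_cst// mul1e.
Qed.

(** Where a continuous density is negative, it is bounded away from zero on
    a small box, and this box would have negative measure. *)
Lemma source_density_ge0 x : 0 <= source_density x.
Proof.
rewrite leNgt; apply/negP => rx.
pose c := source_density x / 2.
have c0 : c < 0 by rewrite /c; lra.
have [e e0 he] : exists2 e : R, 0 < e & forall y, ball x e y ->
  source_density y < c.
  have oc : open (source_density @^-1` [set t | t < c]).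
    by apply: open_comp; [move=> y _; exact: cdens|exact: open_lt].
  have /nbhs_ballP[e /= e0 he] : nbhs x (source_density @^-1` [set t | t < c]).
    by apply: open_nbhs_nbhs; split=> //=; rewrite /c; lra.
  by exists e.
pose I j : set R := `]x 0 j - e, x 0 j + e[%classic.
pose B := [set y : Rd | forall j, I j (y 0 j)].
have mB : measurable B by apply: measurable_box => j; exact: measurable_itv.
have Bcube : B `<=` cube (\sum_j `|x 0 j| + e).
  move=> y yB; apply: (@cube_shift _ _ e _ _ x) => // j; rewrite !mxE.
  by have := yB j; rewrite /I/= in_itv/= -ltr_distl => /ltW.
have Bdens y : B y -> source_density y < c.
  move=> By; apply: he; split => // i j; rewrite ord1 /ball/= distrC.
  by have := By j; rewrite /I/= in_itv/= ltr_distl.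
have leB : lebesgue_rV R d B = ((2 * e) ^+ d)%:E.
  rewrite lebesgue_rV_box; last by move=> j; exact: measurable_itv.
  rewrite -[d in (_ ^+ d)%R]card_ord -prodr_const -prodEFin.
  apply: eq_bigr => j _; rewrite lebesgue_measure_itv/= lte_fin ltrD2l gtrN//.
  by rewrite -EFinD; congr _%:E; ring.
have : (0 <= nu B)%E by exact: measure_ge0.
rewrite (density_cube mB Bcube) leNgt => /negP; apply.
apply: (@le_lt_trans _ _ (\int[leb d]_(y in B) c%:E)%E); last first.
  by rewrite integral_cst// /leb leB -EFinM lte_fin nmulr_rlt0// exprn_gt0// mulr_gt0.
apply: le_integral => //.
- exact: integrable_continuous_cube Bcube cdens.
- by apply: (integrable_continuous_cube (f := fun=> c)) Bcube _ => //;
  exact: cst_continuous.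
- by move=> y /set_mem/Bdens /ltW.
Qed.

(** The identity is known on bounded sets; cubes exhaust the space, and both
    sides are continuous from below. *)
Lemma nu_density A : measurable A ->
  nu A = (\int[leb d]_(x in A) (source_density x)%:E)%E.
Proof.
move=> mA; pose F n := A `&` cube n%:R.
have mF n : measurable (F n) by apply: measurableI => //;
  exact: measurable_cube.
have FE : \bigcup_n F n = A by rewrite -setI_bigcupr bigcup_cube setIT.
have ndF : nondecreasing_seq F.
  move=> m n mn; apply/subsetPset; apply: setIS => x xm j /=.
  have := xm j; rewrite /= !in_itv/= => /andP[H1 H2].
  by apply/andP; split;
    [apply: le_trans H1; rewrite lerN2|apply: le_trans H2 _];
    rewrite ler_nat.
have mEr : measurable_fun setT (EFin \o source_density)
  by exact/measurable_EFinP.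
have r0 x : (0 <= (EFin \o source_density) x)%E
  by rewrite lee_fin source_density_ge0.
pose nu' := density_measure (leb d) mEr r0.
have c1 := nondecreasing_cvg_mu (mu := nu) mF.
have c2 := nondecreasing_cvg_mu (mu := nu') mF.
rewrite FE in c1 c2.
have {}c1 := c1 mA ndF; have {}c2 := c2 mA ndF.
have E : nu \o F = nu' \o F.
  by apply/funext => n; rewrite /comp (@density_cube (F n) n%:R)// => x [].
rewrite E in c1.
exact: (cvg_unique _ c1 c2).
Qed.

End density.

(** * The transportation *)

Section transport.
Context {R : realType} {d : nat}.
Local Notation Rd := 'rV[R]_d.
Variables (nu : {measure set Rd -> \bar R}) (u : Rd -> R) (S L : R).
Hypotheses (nu_fin : locally_finite nu) (uC2 : C2_fun u)
  (nu_u : diff_has_density nu (lebesgue_rV R d) (laplacian u)).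
Hypotheses (L0 : 0 < L) (uS : forall x, 0 <= u x <= S)
  (SL : 4 * d%:R * S <= L ^+ 2).

Local Notation phi := (tspl L (fun=> 2%N) : Rd -> R).
Local Notation K := (jump_rate L u).
Let v (i : 'I_d) : Rd := L *: evec i.
Let rho := source_density u.

Let P (p : Rd * Rd) : R := rho p.1 * phi (p.1 - p.2).
Let M := walk K v phi.
Let N := smoothed K v.

Let cu : continuous u. Proof. by case: uC2 => -[]. Qed.

Let mK i : measurable_fun setT (K i).
Proof. by apply: measurable_jump_rate => // x; have /andP[] := uS x. Qed.

Let K0 i z : 0 <= K i z.
Proof. by have /andP[] := jump_rate_bounds L0 i z cu uS. Qed.

Let Kle i z : K i z <= S / L ^+ 2.
Proof. by have /andP[] := jump_rate_bounds L0 i z cu uS. Qed.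

Let kappa_small : 4 * #|'I_d|%:R * (S / L ^+ 2) <= 1.
Proof. by rewrite card_ord mulrA ler_pdivrMr ?mul1r// exprn_gt0. Qed.

Let mphi : measurable_fun setT phi. Proof. exact: measurable_tspl. Qed.
Let phi0 x : 0 <= phi x. Proof. exact: tspl_ge0. Qed.
Let phi1 w : (\int[leb d]_y (phi (y - w))%:E = 1)%E.
Proof. exact: integral_tspl_sub. Qed.
Let phi1' y : (\int[leb d]_z (phi (y - z))%:E = 1)%E.
Proof. exact: integral_tspl_sub_r. Qed.

Let mP : measurable_fun setT P.
Proof.
apply: measurable_funM.
  apply: measurableT_comp => //; apply: measurable_row_continuous.
  exact: continuous_source_density.
by apply: measurableT_comp => //; exact: measurable_row_sub.
Qed.

Let rho0 x : 0 <= rho x.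
Proof. exact: (source_density_ge0 uC2 nu_u). Qed.

Let P0 p : 0 <= P p. Proof. by rewrite mulr_ge0. Qed.
Let mM : measurable_fun setT M. Proof. exact: measurable_walk. Qed.
Let M0 p : 0 <= M p. Proof. exact: walk_ge0 Kle kappa_small phi0 p. Qed.
Let mN : measurable_fun setT N. Proof. exact: measurable_smoothed. Qed.
Let N0 z : 0 < N z. Proof. exact: smoothed_gt0 K0 Kle kappa_small z. Qed.

Let PN z : (\int[leb d]_x (P (x, z))%:E = (N z)%:E)%E.
Proof.
exact: (pairing_density L0 z uC2).
Qed.

Let MN z : (\int[leb d]_y (M (z, y))%:E = (N z)%:E)%E.
Proof. exact: (integral_walk_r v K0 Kle kappa_small mphi phi0 phi1). Qed.

Let D := glued (leb d) P M N.

Let mD : measurable_fun setT D.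
Proof. exact: measurable_glued. Qed.

Let D0 p : (0 <= D p)%E. Proof. exact: glued_ge0. Qed.

Let gamma := density_measure (leb d \x leb d)%E mD D0.

Let gamma_fst A : measurable A -> gamma (fst @^-1` A) = nu A.
Proof.
move=> mA; rewrite (nu_density uC2 nu_u mA) /gamma density_measure_fst//.
apply: eq_integral => x _; rewrite glued_fst//.
rewrite /P/=; under eq_integral do rewrite EFinM.
rewrite ge0_integralZl//= ?phi1' ?mule1// ?lee_fin//.
- by apply/measurable_EFinP; apply: measurableT_comp => //;
  exact: measurable_row_sub.
- by move=> z _; rewrite lee_fin.
Qed.

Let gamma_snd A : measurable A -> gamma (snd @^-1` A) = lebesgue_rV R d A.
Proof.
move=> mA; rewrite /gamma density_measure_snd//.
transitivity (\int[leb d]_(x in A) (1%:E : \bar R))%E; last first.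
  by rewrite integral_cst// mul1e.
apply: eq_integral => y _; rewrite glued_snd//.
exact: (integral_walk_l v mK K0 Kle kappa_small mphi phi0 phi1').
Qed.

Lemma plan_transportation : transportation nu (lebesgue_rV R d) gamma.
Proof.
split=> [A mA /bounded_fst_cube[r Ar]|f cf _].
  have mr : measurable (fst @^-1` cube r : set (Rd * Rd)).
    by rewrite -[X in measurable X]setTI; apply: measurable_fst => //;
      exact: measurable_cube.
  apply: (@le_lt_trans _ _ (gamma (fst @^-1` cube r))).
    by apply: le_measure; rewrite ?inE.
  rewrite gamma_fst; last exact: measurable_cube.
  by apply: nu_fin; [exact: measurable_cube|exact: bounded_cube].
have mf : measurable_fun setT (EFin \o f).
  by apply/measurable_EFinP; exact: measurable_row_continuous.
split.
- exact: (integral_marginal measurable_fst mf gamma_fst).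
- exact: (integral_marginal measurable_snd mf gamma_snd).
Qed.

(** Some intermediate [z] has each coordinate of [x - z] in [[0, 3 L]]. The
    point [y] is at most [3 L] above its starting point, which differs from [z]
    by at most [L], so each coordinate of [y - z] is in [[- L, 4 L]]. *)
Lemma plan_supp x y : D (x, y) != 0%E -> forall j, `|x 0 j - y 0 j| <= 4 * L.
Proof.
have supp (z w : Rd) : phi (z - w) != 0 ->
  forall j, 0 <= z 0 j - w 0 j <= 3 * L.
  by move=> zw j; have := tspl_supp L0 (fun=> leqnn 2) zw j; rewrite !mxE.
have vL i j : 0 <= (v i) 0 j <= L.
  by rewrite /v !mxE eqxx/=; case: (j == i); rewrite ?mulr1 ?mulr0 ?lexx ltW.
move=> /glued_neq0[z []]; rewrite /P mulf_eq0 negb_or => /andP[_ /supp/= xz].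
move=> /walk_neq0 yz j; have {}xz := xz j.
have {}yz : - L <= y 0 j - z 0 j <= 4 * L.
  case: yz => [/supp /(_ j)|[i [|] /supp /(_ j)]].
  - by move: L0; lra.
  - by have := vL i j; rewrite !mxE; move: L0; lra.
  - by have := vL i j; rewrite !mxE; move: L0; lra.
by rewrite ler_norml; move: L0; lra.
Qed.

Lemma plan_spt z : spt gamma z -> forall j, `|z.1 0 j - z.2 0 j| <= 4 * L.
Proof.
move=> sz j; rewrite leNgt; apply/negP => zj.
pose U := [set z : Rd * Rd | 4 * L < `|z.1 0 j - z.2 0 j|].
have g0 : gamma U = 0%E.
  apply: integral0_eq => -[x y] /= xy; apply/eqP.
  by apply: contraLR xy => /plan_supp /(_ j); rewrite leNgt.
have : (0 < gamma U)%E by exact: (sz _ (@open_coord_gt R d (4 * L) j) zj).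
by rewrite g0 ltxx.
Qed.

Lemma Tra_le : (Tra nu <= (Num.sqrt d%:R * (4 * L))%:E)%E.
Proof.
have L4 : 0 <= 4 * L by rewrite mulr_ge0// ltW.
apply: (@le_trans _ _ (transport_cost gamma)).
  by apply: ereal_inf_lbound; exists gamma => //; exact: plan_transportation.
rewrite /transport_cost ge_max lee_fin mulr_ge0 ?sqrtr_ge0//=.
apply: ge_ereal_sup => _ [z sz <-]; rewrite lee_fin.
by apply: enorm_le => // j; rewrite !mxE; exact: plan_spt.
Qed.

End transport.

Section shift.
Context {R : realType} {d : nat}.
Local Notation Rd := 'rV[R]_d.

Let quotient_addc (u : Rd -> R) c (x v : Rd) :
  (fun h : R => h^-1 *: (((fun y => u y + c) \o shift x) (h *: v) - (u x + c))) =
  (fun h : R => h^-1 *: ((u \o shift x) (h *: v) - u x)).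
Proof. by apply/funext => h /=; rewrite opprD addrACA subrr addr0. Qed.

Lemma partial_addc i (u : Rd -> R) c :
  partial i (fun x => u x + c) = partial i u.
Proof. by apply/funext => x; rewrite /partial /derive quotient_addc. Qed.

Lemma derivable_addc (u : Rd -> R) c x v :
  derivable u x v -> derivable (fun x => u x + c) x v.
Proof. by rewrite /derivable quotient_addc. Qed.

Lemma C2_addc (u : Rd -> R) c : C2_fun u -> C2_fun (fun x => u x + c).
Proof.
move=> [[cu du] ddu]; split; last by move=> i; rewrite partial_addc.
split=> [|i]; last first.
  by rewrite partial_addc; have [dui cui] := du i; split=> // x;
    exact: derivable_addc.
by move=> x; apply: (@continuousD _ R Rd) =>
  //; [exact: cu|exact: cst_continuous].
Qed.

Lemma laplacian_addc (u : Rd -> R) c :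
  laplacian (fun x => u x + c) = laplacian u.
Proof.
by apply/funext => x; apply: eq_bigr => i _; rewrite partial_addc.
Qed.

End shift.

Theorem corollary1p5 (R : realType) (d : nat) (hd : (1 <= d)%N) :
  exists2 C : R, 0 < C &
    forall (nu : {measure set 'rV[R]_d -> \bar R}) (u : 'rV[R]_d -> R),
      locally_finite nu -> C2_fun u ->
      diff_has_density nu (lebesgue_rV R d) (laplacian u) ->
      (Tra nu <= C%:E * sqrte (sup_norm u))%E.
Proof.
have d0 : 0 < d%:R :> R by rewrite ltr0n.
pose c : R := Num.sqrt d%:R * 4.
have c0 : 0 < c by rewrite mulr_gt0// sqrtr_gt0.
exists (c * Num.sqrt (8 * d%:R));
  first by rewrite mulr_gt0// sqrtr_gt0 mulr_gt0.
move=> nu u nu_fin uC2 nu_u.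
have u_le x : (`|u x|%:E <= sup_norm u)%E by apply: ereal_sup_ubound; exists x.
case: (sup_norm u) u_le => [s| |] u_le.
- have s0 : 0 <= s by have := u_le 0; rewrite lee_fin; apply: le_trans.
  have us x : 0 <= u x + s <= 2 * s.
    by have := u_le x; rewrite lee_fin ler_norml; lra.
  rewrite /= -EFinM; apply/lee_addgt0Pr => e e0; rewrite -EFinD.
  (* The slack [e] makes [L] positive even when [u] vanishes; the plan
     at scale [L] costs at most [c * L]. *)
  pose L := Num.sqrt (8 * d%:R * s) + e / c.
  have ec : 0 < e / c by rewrite divr_gt0.
  have L0 : 0 < L by rewrite ltr_wpDl// sqrtr_ge0.
  have := @Tra_le R d nu (fun x => u x + s) (2 * s) L nu_fin (C2_addc s uC2).
  rewrite laplacian_addc => /(_ nu_u L0 us).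
  have -> : Num.sqrt d%:R * (4 * L) = c * Num.sqrt (8 * d%:R) * Num.sqrt s + e.
    have -> : c * Num.sqrt (8 * d%:R) * Num.sqrt s = c * Num.sqrt (8 * d%:R * s).
      by rewrite -mulrA -sqrtrM// mulr_ge0// ltW.
    by rewrite mulrA -/c /L mulrDr (mulrC e) mulVKf ?gt_eqF.
  apply.
  have ds0 : 0 <= 8 * d%:R * s by rewrite !mulr_ge0// ltW.
  have -> : 4 * d%:R * (2 * s) = Num.sqrt (8 * d%:R * s) ^+ 2.
    by rewrite sqr_sqrtr//; ring.
  by rewrite lerXn2r ?nnegrE ?sqrtr_ge0 ?ltW// /L ltrDl.
- by rewrite /= gt0_muley ?leey// lte_fin mulr_gt0// sqrtr_gt0 mulr_gt0.
- by have := u_le 0; rewrite leeNy_eq.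
Qed.
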